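(* Let $X$ be a compact Polish space and let $X^\#=(X,d,(p_n)_{n\in\mathbb{N}})$ be a computably compact presentation of $X$. Then there is a computable presentation $C^*(X)^\#$ of $C^*(X)$ such that: (1) $\widehat{p_n}$ is a computable functional of $C^*(X)^\#$ uniformly in $n$; and (2) $\vec{d}_{p_n}$ is a computable vector of $C^*(X)^\#$ uniformly in $n$.
   Context: For a compact Polish space $X$, $C^*(X)$ is the commutative unital $C^*$-algebra of continuous functions $X\to\mathbb{C}$ with the sup norm, pointwise operations and complex conjugation as involution. For $p\in X$, $\widehat{p}:C^*(X)\to\mathbb{C}$ is $f\mapsto f(p)$, and $\vec{d}_p\in C^*(X)$ is $q\mapsto d(p,q)$. A presentation of a metric space $(M,d)$ is $M^\#=(M,(s_n)_{n\in\mathbb{N}})$ with $(s_n)$ dense (distinguished points); a presentation of $X$ is $X^\#=(X,d,(p_n))$ with $d$ a compatible metric. $M^\#$ is computable if $d(s_j,s_k)$ is computable uniformly in $j,k$. A name of $x$ is a sequence $(n_k)$ with $d(s_{n_k},x)<2^{-k}$; $x$ is a computable point if it has a computable name (uniformly in $n$ for a sequence: names computable uniformly in $n$); a map between presented spaces is computable if some oracle Turing machine transforms every name of any input into a name of its image (uniformly in $n$ for a sequence of maps); $\mathbb{C}$ has its standard presentation. A total boundedness function of $M^\#$ is $f:\mathbb{N}\to\mathbb{N}$ such that $f(j)$ codes a finite $F\subseteq\mathbb{N}$ with $M=\bigcup_{k\in F}B(s_k;2^{-j})$; $M^\#$ is computably compact if it is computable and has a computable total boundedness function. Fix an effective enumeration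 $(\mathfrak{p}_n)$ of the $*$-polynomials with coefficients in $\mathbb{Q}(i)$ in variables $x_0,x_1,\dots$. A presentation of a $C^*$-algebra $A$ is $A^\#=(A,(u_n))$ such that the rational vectors $\mathfrak{p}_n[A^\#]$ (substitute $u_j$ for $x_j$) are dense in $A$; it is computable if $\|\mathfrak{p}_n[A^\#]\|$ is computable uniformly in $n$. It is regarded as a presented metric space with the rational vectors as distinguished points, so computable vectors are the computable points of this space, and a computable functional of $A^\#$ is a computable map from $A^\#$ to $\mathbb{C}$. *)

(* Defs.v *)
From HB Require Import structures.
From mathcomp Require Import all_boot all_order all_algebra.
From mathcomp Require Import all_classical all_reals all_analysis.
From mathcomp Require Import complex.

Set Implicit Arguments.
Unset Strict Implicit.
Unset Printing Implicit Defensive.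
Import Order.TTheory GRing.Theory Num.Theory.
Import numFieldNormedType.Exports.

(** Partial recursive functions relative to an oracle (Kleene), i.e. exactly the
partial functions computed by oracle Turing machines.  Arguments are lists;
the basic functions read an absent argument as 0. *)

Inductive code : Type :=
  | Zero
  | Succ
  | Proj of nat
  | Oracle
  | Comp of code & seq code
  | PrimRec of code & code
  | Mu of code.

(** [eval o c s v]: the program [c] with oracle [o] halts on input [s] with
output [v]. *)
Inductive eval (o : nat -> nat) : code -> seq nat -> nat -> Prop :=
  | eval_zero s : eval o Zero s 0
  | eval_succ s : eval o Succ s (nth 0 s 0).+1
  | eval_proj i s : eval o (Proj i) s (nth 0 s i)
  | eval_oracle s : eval o Oracle s (o (nth 0 s 0))
  | eval_comp f gs s ts v :
      size ts = size gs ->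
      (forall i, (i < size gs)%N -> eval o (nth Zero gs i) s (nth 0 ts i)) ->
      eval o f ts v -> eval o (Comp f gs) s v
  | eval_rec0 f g s v : eval o f s v -> eval o (PrimRec f g) (0 :: s) v
  | eval_recS f g n s w v :
      eval o (PrimRec f g) (n :: s) w -> eval o g [:: n, w & s] v ->
      eval o (PrimRec f g) (n.+1 :: s) v
  | eval_mu f s n (w : nat -> nat) :
      eval o f (n :: s) 0 ->
      (forall m, (m < n)%N -> eval o f (m :: s) (w m).+1) ->
      eval o (Mu f) s n.

(** Computability without oracle is computability relative to a computable
one. *)
Definition no_oracle : nat -> nat := fun=> 0.

Definition computable1 (f : nat -> nat) : Prop :=
  exists c, forall i, eval no_oracle c [:: i] (f i).

Definition computable2 (f : nat -> nat -> nat) : Prop :=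
  exists c, forall i j, eval no_oracle c [:: i; j] (f i j).

Definition computable3 (f : nat -> nat -> nat -> nat) : Prop :=
  exists c, forall i j k, eval no_oracle c [:: i; j; k] (f i j k).

Lemma eval_functional o c s v v' : eval o c s v -> eval o c s v' -> v = v'.
Proof.
move=> ev; elim: ev v' => {c s v}.
- by move=> s v' H; inversion H.
- by move=> s v' H; inversion H.
- by move=> i s v' H; inversion H.
- by move=> s v' H; inversion H.
- move=> f gs s ts v sz _ IH _ IHf v' H.
  inversion H as [| | | |f' gs' s' ts' w sz' evs evf| | |]; subst.
  apply: IHf; suff -> : ts = ts' by [].
  apply: (@eq_from_nth _ 0); first by rewrite sz.
  by move=> i; rewrite sz => ii; apply: IH => //; exact: evs.
- by move=> f g s v _ IH v' H; inversion H; subst; exact: IH.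
- move=> f g n s w v _ IH _ IHg v' H.
  inversion H as [| | | | | |f' g' n' s' w' u evw evu|]; subst.
  by apply: IHg; rewrite (IH _ evw).
- move=> f s n w _ IH _ IHm v' H.
  inversion H as [| | | | | | |f' s' n' w' ev0 evS]; subst.
  case: (ltngtP n v') => // h; first by have := IH _ (evS _ h).
  by have := IHm _ h _ ev0.
Qed.

Local Open Scope classical_set_scope.
Local Open Scope ring_scope.

(** Finite objects are coded through the bijection [CodeSeq.decode : nat -> seq nat]. *)

Definition decode_rat (n : nat) : rat :=
  let s := CodeSeq.decode n in
  ((nth 0%N s 0)%:Q - (nth 0%N s 1)%:Q) / (nth 0%N s 2).+1%:Q.

Definition decode_qi (n : nat) : rat * rat :=
  let s := CodeSeq.decode n in (decode_rat (nth 0%N s 0), decode_rat (nth 0%N s 1)).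

(** A *-polynomial over Q(i) is a formal sum of monomials [(q, w)], where the
word [w] is a product of letters, [(j, false)] standing for x_j and [(j, true)]
for x_j^*.  The empty word is the constant monomial. *)
Definition star_monomial : Type := ((rat * rat) * seq (nat * bool))%type.
Definition star_poly : Type := seq star_monomial.

Definition decode_monomial (n : nat) : star_monomial :=
  let s := CodeSeq.decode n in
  (decode_qi (head 0%N s), [seq (l./2, odd l) | l <- behead s]).

Definition decode_poly (n : nat) : star_poly :=
  [seq decode_monomial m | m <- CodeSeq.decode n].

Lemma decode_rat_surj (q : rat) : exists n, decode_rat n = q.
Proof.
have dE : (`|denq q|.-1).+1%:Q = (denq q)%:Q.
  by rewrite prednK ?absz_gt0 ?denq_neq0// absz_denq.
case nE : (numq q) => [a|a].
- exists (CodeSeq.code [:: a; 0; `|denq q|.-1]%N).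
  by rewrite /decode_rat CodeSeq.codeK /= dE subr0 -[RHS]divq_num_den nE.
- exists (CodeSeq.code [:: 0; a.+1; `|denq q|.-1]%N).
  rewrite /decode_rat CodeSeq.codeK /= dE sub0r -[RHS]divq_num_den nE.
  by rewrite NegzE mulrNz.
Qed.

Lemma decode_monomial_surj (m : star_monomial) : exists n, decode_monomial n = m.
Proof.
case: m => [[q r] w].
have [a aq] := decode_rat_surj q; have [b br] := decode_rat_surj r.
pose l (x : nat * bool) : nat := (x.2 + x.1.*2)%N.
have [c cqr] : exists c, decode_qi c = (q, r).
  by exists (CodeSeq.code [:: a; b]); rewrite /decode_qi CodeSeq.codeK /= aq br.
exists (CodeSeq.code (c :: map l w)).
rewrite /decode_monomial CodeSeq.codeK /= cqr.
congr (_, _); rewrite -map_comp -[RHS]map_id; apply: eq_map => -[j t] /=.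
by rewrite /l /= half_bit_double oddD odd_double addbF oddb.
Qed.

Lemma decode_poly_surj (P : star_poly) : exists n, decode_poly n = P.
Proof.
have [s sP] : exists s, map decode_monomial s = P.
  elim: P => [|m P [s sP]]; first by exists [::].
  by have [n nm] := decode_monomial_surj m; exists (n :: s); rewrite /= nm sP.
by exists (CodeSeq.code s); rewrite /decode_poly CodeSeq.codeK.
Qed.

Record presented_space (R : realType) := PresentedSpace {
  carrier : Type ;
  dist : carrier -> carrier -> R ;
  pt : nat -> carrier }.

Section presented_spaces.
Variable R : realType.
Implicit Types M N : presented_space R.

Definition dense_points M : Prop :=
  forall (x : carrier M) (e : R), 0 < e -> exists n, dist (pt M n) x < e.

Definition is_name M (x : carrier M) (nu : nat -> nat) : Prop :=
  forall k, dist (pt M (nu k)) x < 2 ^- k.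

Definition computable_points M (x : nat -> carrier M) : Prop :=
  exists2 f, computable2 f & forall n, is_name (x n) (f n).

Definition computable_points2 M (x : nat -> nat -> carrier M) : Prop :=
  exists2 f, computable3 f & forall i j, is_name (x i j) (f i j).

(** Uniform computability of the maps [F n]: one program, with a name of the
input as oracle, computes from [n] and [k] the [k]-th entry of a name of the
output. *)
Definition computable_maps M N (F : nat -> carrier M -> carrier N) : Prop :=
  exists c : code, forall n x nu, is_name x nu ->
    exists2 mu, is_name (F n x) mu & forall k, eval nu c [:: n; k] (mu k).

Definition real_space : presented_space R :=
  {| carrier := R ; dist x y := `|x - y| ; pt n := ratr (decode_rat n) |}.

Definition computable_space M : Prop :=
  @computable_points2 real_space (fun j k => dist (pt M j) (pt M k)).

Definition total_boundedness_function M (f : nat -> nat) : Prop :=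
  forall j (x : carrier M),
    exists2 k, k \in CodeSeq.decode (f j) & dist (pt M k) x < 2 ^- j.

Definition computably_compact M : Prop :=
  computable_space M /\
  exists2 f, computable1 f & total_boundedness_function M f.

End presented_spaces.

(* Typed as a field so that it carries the library's norm topology. *)
Definition cplx (R : realType) : numClosedFieldType := R[i]%C.

Definition modulus (R : realType) (z : cplx R) : R := Normc.normc z.

Definition cplx_of_qi (R : realType) (q : rat * rat) : cplx R :=
  Complex (ratr q.1) (ratr q.2).

Definition complex_space (R : realType) : presented_space R :=
  {| carrier := cplx R ;
     dist z w := modulus (z - w) ;
     pt n := cplx_of_qi R (decode_qi n) |}.

Record compatible_metric (R : realType) (X : topologicalType)
    (d : X -> X -> R) : Prop := CompatibleMetric {
  metric_refl : forall x, d x x = 0 ;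
  metric_eq : forall x y, d x y = 0 -> x = y ;
  metric_symm : forall x y, d x y = d y x ;
  metric_tri : forall x y z, d x z <= d x y + d y z ;
  metric_nbhs : forall x,
    nbhs x = filter_from [set e | 0 < e] (fun e => [set y | d x y < e]) }.

Definition complete_metric (R : realType) (X : topologicalType)
    (d : X -> X -> R) : Prop :=
  forall u : nat -> X,
    (forall e : R, 0 < e ->
       exists N, forall m n, (N <= m)%N -> (N <= n)%N -> d (u m) (u n) < e) ->
    exists l : X, u @ \oo --> l.

Definition polish (R : realType) (X : topologicalType) : Prop :=
  (exists2 D : set X, countable D & dense D) /\
  exists2 d : X -> X -> R, compatible_metric d & complete_metric d.

Record presentation (R : realType) (X : topologicalType) := Presentation {
  metric : X -> X -> R ;
  dpoint : nat -> X ;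
  metricP : compatible_metric metric ;
  dpoint_dense : dense (range dpoint) }.

Definition space_of (R : realType) (X : topologicalType)
    (P : presentation R X) : presented_space R :=
  {| carrier := X ; dist := metric P ; pt := dpoint P |}.

Definition Cstar (R : realType) (X : topologicalType) :=
  continuousType X (cplx R).

HB.instance Definition _ R X := Choice.on (Cstar R X).

Section Cstar_operations.
Variables (R : realType) (X : topologicalType).
Local Notation C := (cplx R).
Implicit Types f g : Cstar R X.

Let continuous_of f : continuous (f : X -> C).
Proof. exact: cts_fun. Qed.

Let cts_add f g : continuous (fun x => f x + g x : C).
Proof. by move=> x; apply: cvgD; exact: continuous_of. Qed.

Let cts_opp f : continuous (fun x => - f x : C).
Proof. by move=> x; apply: cvgN; exact: continuous_of. Qed.

Let cts_mul f g : continuous (fun x => f x * g x : C).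
Proof. by move=> x; apply: cvgM; exact: continuous_of. Qed.

Let cts_scale (a : C) f : continuous (fun x => a * f x : C).
Proof. by move=> x; apply: cvgM; [exact: cvg_cst|exact: continuous_of]. Qed.

Let cts_conj f : continuous (fun x => (f x)^* : C).
Proof.
move=> x; apply/cvgrPdist_lt => e e0.
have /cvgrPdist_lt/(_ e e0) := @continuous_of f x.
by apply: filterS => y; rewrite -rmorphB norm_conjC.
Qed.

Definition Cstar_cst (a : C) : Cstar R X := cst a.
Definition Cstar_add f g : Cstar R X := mkcts (@cts_add f g).
Definition Cstar_opp f : Cstar R X := mkcts (@cts_opp f).
Definition Cstar_mul f g : Cstar R X := mkcts (@cts_mul f g).
Definition Cstar_scale (a : C) f : Cstar R X := mkcts (@cts_scale a f).
Definition Cstar_star f : Cstar R X := mkcts (@cts_conj f).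

Let addA : associative Cstar_add.
Proof. by move=> f g h; apply/continuousEP => x; exact: addrA. Qed.
Let addC : commutative Cstar_add.
Proof. by move=> f g; apply/continuousEP => x; exact: addrC. Qed.
Let add0 : left_id (Cstar_cst 0) Cstar_add.
Proof. by move=> f; apply/continuousEP => x; exact: add0r. Qed.
Let addN : left_inverse (Cstar_cst 0) Cstar_opp Cstar_add.
Proof. by move=> f; apply/continuousEP => x; exact: addNr. Qed.

HB.instance Definition _ :=
  GRing.isZmodule.Build (Cstar R X) addA addC add0 addN.

Let mulA : associative Cstar_mul.
Proof. by move=> f g h; apply/continuousEP => x; exact: mulrA. Qed.
Let mulC : commutative Cstar_mul.
Proof. by move=> f g; apply/continuousEP => x; exact: mulrC. Qed.
Let mul1 : left_id (Cstar_cst 1) Cstar_mul.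
Proof. by move=> f; apply/continuousEP => x; exact: mul1r. Qed.
Let mulD : left_distributive Cstar_mul Cstar_add.
Proof. by move=> f g h; apply/continuousEP => x; exact: mulrDl. Qed.

HB.instance Definition _ :=
  GRing.Zmodule_isComPzRing.Build (Cstar R X) mulA mulC mul1 mulD.

Let scaleA a b f : Cstar_scale a (Cstar_scale b f) = Cstar_scale (a * b) f.
Proof. by apply/continuousEP => x; exact: mulrA. Qed.
Let scale1 : left_id 1 Cstar_scale.
Proof. by move=> f; apply/continuousEP => x; exact: mul1r. Qed.
Let scaleDr : right_distributive Cstar_scale +%R.
Proof. by move=> a f g; apply/continuousEP => x; exact: mulrDr. Qed.
Let scaleDl f : {morph Cstar_scale^~ f : a b / a + b}.
Proof. by move=> a b; apply/continuousEP => x; exact: mulrDl. Qed.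

HB.instance Definition _ :=
  GRing.Zmodule_isLmodule.Build C (Cstar R X) scaleA scale1 scaleDr scaleDl.

End Cstar_operations.

Definition sup_norm (R : realType) (X : topologicalType) (f : Cstar R X) : R :=
  sup (range (fun x => modulus (f x))).

(** The value of a *-polynomial when [u j] is substituted for x_j. *)
Definition star_poly_eval (R : realType) (X : topologicalType)
    (u : nat -> Cstar R X) (P : star_poly) : Cstar R X :=
  \sum_(m <- P) cplx_of_qi R m.1 *:
    \prod_(l <- m.2) (if l.2 then Cstar_star (u l.1) else u l.1).

Definition rational_vector (R : realType) (X : topologicalType)
    (u : nat -> Cstar R X) (n : nat) : Cstar R X :=
  star_poly_eval u (decode_poly n).

Definition Cstar_space (R : realType) (X : topologicalType)
    (u : nat -> Cstar R X) : presented_space R :=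
  {| carrier := Cstar R X ;
     dist f g := sup_norm (f - g) ;
     pt := rational_vector u |}.

Record Cstar_presentation (R : realType) (X : topologicalType) :=
  CstarPresentation {
    generator : nat -> Cstar R X ;
    rational_vector_dense : dense_points (Cstar_space generator) }.

Definition space_of_Cstar (R : realType) (X : topologicalType)
    (A : Cstar_presentation R X) : presented_space R :=
  Cstar_space (generator A).

Definition computable_Cstar_presentation (R : realType) (X : topologicalType)
    (A : Cstar_presentation R X) : Prop :=
  @computable_points R (real_space R)
    (fun n => sup_norm (rational_vector (generator A) n)).

Definition hat (R : realType) (X : topologicalType) (p : X) (f : Cstar R X) :
  cplx R := f p.

Lemma continuous_dist (R : realType) (X : topologicalType) (d : X -> X -> R)
    (dP : compatible_metric d) (p : X) :
  continuous (fun q => Complex (d p q) 0 : cplx R).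
Proof.
move=> x; apply/cvgrPdist_lt => -[e e'] e0.
have [/eqP e'0 {}e0] : e' == 0 /\ 0 < e by move: e0; rewrite ltcE/= => /andP[].
rewrite near_simpl /prop_near1 (metric_nbhs dP); exists e => // y /= xy.
rewrite [X in X < _](_ : _ = Complex `|d p x - d p y| 0); last first.
  by rewrite /Num.Def.normr/= subr0 expr0n/= addr0 sqrtr_sqr.
rewrite ltcE/= e'0 eqxx/= ltr_norml; apply/andP; split.
- by rewrite ltrNl opprB ltrBlDl (le_lt_trans (metric_tri dP p x y))// ltrD2l.
- rewrite ltrBlDl (le_lt_trans (metric_tri dP p y x))// ltrD2l.
  by rewrite (metric_symm dP).
Qed.

Definition dist_vector (R : realType) (X : topologicalType)
    (P : presentation R X) (p : X) : Cstar R X :=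
  mkcts (@continuous_dist R X (metric P) (metricP P) p).

(* Main.v *)
Require Import Defs.
From mathcomp Require Import all_boot all_order all_algebra.
From mathcomp Require Import all_classical all_reals all_analysis.
From mathcomp Require Import complex.
From mathcomp Require Import ring lra zify.

(** The generators are the minima [min(b, q_1 + L_1 d(-, p_(k_1)), ...)] with
rational data.  They already form a dense set of real functions: on a compact
space every continuous [h] satisfies [h x <= h y + L d(x, y) + e] for some [L],
so that the minimum over a fine net of [h(p_k) + L d(-, p_k)] is close to [h].
The functions [d(-, p_n)] are generators themselves, as soon as [b] bounds [d].

Replacing the distances [d(p_i, x)] by rational intervals valid for all [x] near
[p_k] and computing with intervals encloses a rational vector near [p_k]; the
radii tend to 0 with the precision uniformly in [k], hence a search finds a
sufficient precision without any error estimate.  One distinguished point gives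
the evaluation functionals, a finite net gives the norm.

Computability is handled for functions between numbered types, i.e. types with
a surjection from the natural numbers, on the codes of which a program works. *)

Set Implicit Arguments.
Unset Strict Implicit.
Unset Printing Implicit Defensive.
Import Order.TTheory GRing.Theory Num.Theory.
Import numFieldNormedType.Exports.

Local Notation eval := Defs.eval.

(** * Total functions computable from every oracle *)

(** One program has to serve all oracles: the same function can then be used without oracle and
    inside a program that consults a name. *)
Definition rec_fun (n : nat) (F : seq nat -> nat) : Prop :=
  exists c, forall o s, size s = n -> eval o c s (F s).

Definition rec_funs (n : nat) (Gs : seq (seq nat -> nat)) : Prop :=
  exists2 cs, size cs = size Gs & forall o s i, size s = n -> (i < size Gs)%N ->
    eval o (nth Zero cs i) s (nth 0 [seq G s | G <- Gs] i).

Lemma rec_funs_nil n : rec_funs n [::].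
Proof. by exists [::]. Qed.

Lemma rec_funs_cons n G Gs :
  rec_fun n G -> rec_funs n Gs -> rec_funs n (G :: Gs).
Proof.
move=> [c cG] [cs szcs csGs]; exists (c :: cs); first by rewrite /= szcs.
by move=> o s [|i] sn ilt /=; [exact: cG|exact: csGs].
Qed.

Lemma rec_fun_comp n F Gs : rec_fun (size Gs) F -> rec_funs n Gs ->
  rec_fun n (fun s => F [seq G s | G <- Gs]).
Proof.
move=> [c cF] [cs szcs csGs]; exists (Comp c cs) => o s sn.
apply: (eval_comp (ts := [seq G s | G <- Gs])).
- by rewrite size_map.
- by rewrite szcs => i ilt; exact: csGs.
- by apply: cF; rewrite size_map.
Qed.

Lemma rec_fun_ext n F G :
  (forall s, size s = n -> F s = G s) -> rec_fun n F -> rec_fun n G.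
Proof. by move=> FG [c cF]; exists c => o s sn; rewrite -FG//; exact: cF. Qed.

Lemma rec_fun_proj n i : rec_fun n (fun s => nth 0 s i).
Proof. by exists (Proj i) => o s _; constructor. Qed.

Lemma rec_fun_succ n F : rec_fun n F -> rec_fun n (fun s => (F s).+1).
Proof.
move=> nF; apply: (@rec_fun_comp n (fun s => (nth 0 s 0).+1) [:: F]).
  by exists Succ => o s _; constructor.
exact/rec_funs_cons/rec_funs_nil.
Qed.

Lemma rec_fun_cst n k : rec_fun n (fun=> k).
Proof.
elim: k => [|k IH]; first by exists Zero => o s _; constructor.
exact: rec_fun_succ.
Qed.

Definition rec_fun1 (f : nat -> nat) := rec_fun 1 (fun s => f (nth 0 s 0)).
Definition rec_fun2 (f : nat -> nat -> nat) :=
  rec_fun 2 (fun s => f (nth 0 s 0) (nth 0 s 1)).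

Lemma rec_fun1_comp f n F : rec_fun1 f -> rec_fun n F ->
  rec_fun n (fun s => f (F s)).
Proof.
by move=> fr Fr; exact: (@rec_fun_comp n _ [:: F] fr
  (rec_funs_cons Fr (rec_funs_nil n))).
Qed.

Lemma rec_fun2_comp f n F G : rec_fun2 f -> rec_fun n F -> rec_fun n G ->
  rec_fun n (fun s => f (F s) (G s)).
Proof.
by move=> fr Fr Gr; exact: (@rec_fun_comp n _ [:: F; G] fr
  (rec_funs_cons Fr (rec_funs_cons Gr (rec_funs_nil n)))).
Qed.

Lemma rec_fun_rec n F G : rec_fun n F -> rec_fun n.+2 G ->
  rec_fun n.+1 (fun s =>
    nat_rec (fun=> nat) (F (behead s)) (fun k w => G [:: k, w & behead s])
      (nth 0 s 0)).
Proof.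
move=> [c cF] [d dG]; exists (PrimRec c d) => o [//|m s] [] sn /=.
elim: m => [|m IH] /=; first by apply: eval_rec0; exact: cF.
by apply: eval_recS IH _; apply: dG; rewrite /= sn.
Qed.

(** A zero is demanded for every list, whatever its length, so that [ex_minn] defines a total
    function. *)
Lemma rec_fun_mu n F (exF : forall s, exists k, F (k :: s) == 0) :
  rec_fun n.+1 F -> rec_fun n (fun s => ex_minn (exF s)).
Proof.
move=> [c cF]; exists (Mu c) => o s sn; case: ex_minnP => k /eqP k0 kmin.
(* [eval_mu] wants the nonzero values as successors, hence the predecessor. *)
apply: (@eval_mu _ _ _ _ (fun m => (F (m :: s)).-1)).
  by rewrite -k0; apply: cF; rewrite /= sn.
move=> m mk; rewrite prednK; first by apply: cF; rewrite /= sn.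
by rewrite lt0n; apply/negP => /kmin; rewrite leqNgt mk.
Qed.

(** * Elementary arithmetic on natural numbers and on codes of lists *)

Lemma rec_add : rec_fun2 addn.
Proof.
apply: rec_fun_ext (rec_fun_rec (rec_fun_proj 1 0)
  (rec_fun_succ (rec_fun_proj 3 1))) => -[|a [|b []]]//= _.
by elim: a => //= a ->; rewrite addSn.
Qed.

Lemma rec_mul : rec_fun2 muln.
Proof.
apply: rec_fun_ext (rec_fun_rec (rec_fun_cst 1 0)
  (rec_fun2_comp rec_add (rec_fun_proj 3 2) (rec_fun_proj 3 1)))
  => -[|a [|b []]]//= _.
by elim: a => //= a ->; rewrite mulSn.
Qed.

Lemma rec_pred : rec_fun1 predn.
Proof.
apply: rec_fun_ext (rec_fun_rec (rec_fun_cst 0 0) (rec_fun_proj 2 0))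
  => -[|a []]//= _.
by case: a.
Qed.

Lemma rec_sub : rec_fun2 subn.
Proof.
(* Recursion runs on the first argument, whereas subtraction recurses on the subtracted number. *)
have sub' : rec_fun2 (fun a b => b - a)%N.
  apply: rec_fun_ext (rec_fun_rec (rec_fun_proj 1 0)
    (rec_fun1_comp rec_pred (rec_fun_proj 3 1))) => -[|a [|b []]]//= _.
  by elim: a => [|a /= ->]; [rewrite subn0|rewrite subnS].
exact: rec_fun2_comp sub' (rec_fun_proj 2 1) (rec_fun_proj 2 0).
Qed.

Lemma rec_if n C F G : rec_fun n C -> rec_fun n F -> rec_fun n G ->
  rec_fun n (fun s => if (0 < C s)%N then F s else G s).
Proof.
have if3 : rec_fun 3
    (fun s => if (0 < nth 0 s 0)%N then nth 0 s 1 else nth 0 s 2).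
  apply: rec_fun_ext (rec_fun_rec (rec_fun_proj 2 1) (rec_fun_proj 4 2))
    => -[|c [|x [|y []]]]//= _.
  by case: c.
move=> Cr Fr Gr; apply: (@rec_fun_comp n _ [:: C; F; G] if3).
by do 3![apply: rec_funs_cons => //]; exact: rec_funs_nil.
Qed.

(** The recursion is [a.+1./2 = a - a./2]. *)
Lemma rec_half : rec_fun1 half.
Proof.
apply: rec_fun_ext (rec_fun_rec (rec_fun_cst 0 0)
  (rec_fun2_comp rec_sub (rec_fun_proj 2 0) (rec_fun_proj 2 1)))
  => -[|a []]//= _.
by elim: a => //= a ->; lia.
Qed.

Lemma rec_double : rec_fun1 double.
Proof.
apply: rec_fun_ext (rec_fun2_comp rec_add (rec_fun_proj 1 0)
  (rec_fun_proj 1 0)) => s _.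
by rewrite addnn.
Qed.

Lemma rec_odd : rec_fun1 odd.
Proof.
apply: rec_fun_ext (rec_fun2_comp rec_sub (rec_fun_proj 1 0)
  (rec_fun1_comp rec_double (rec_fun1_comp rec_half (rec_fun_proj 1 0))))
  => s _.
by rewrite -{1}[nth 0 s 0]odd_double_half addnK.
Qed.

Lemma rec_iter_half : rec_fun2 (fun k n => iter k half n).
Proof.
apply: rec_fun_ext (rec_fun_rec (rec_fun_proj 1 0)
  (rec_fun1_comp rec_half (rec_fun_proj 3 1))) => -[|k [|n []]] //=.
Qed.

Lemma rec_pow2 : rec_fun1 (expn 2).
Proof.
apply: rec_fun_ext (rec_fun_rec (rec_fun_cst 0 1)
  (rec_fun1_comp rec_double (rec_fun_proj 2 1))) => -[|k []]//= _.
by elim: k => //= k ->; rewrite expnS mul2n.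
Qed.

(** The step of the library coding of lists: it turns the code of [s] into that of [x :: s]; the
    empty list has code 0. *)
Definition code_cons x c := (2 ^ x * c.*2.+1)%N.

Lemma rec_code_cons : rec_fun2 code_cons.
Proof.
apply: rec_fun2_comp rec_mul (rec_fun1_comp rec_pow2 (rec_fun_proj 2 0)) _.
exact/rec_fun_succ/(rec_fun1_comp rec_double)/rec_fun_proj.
Qed.

Lemma iter_half_code_cons x c k : (k <= x)%N ->
  iter k half (code_cons x c) = code_cons (x - k) c.
Proof.
elim: k x => [|k IH] x kx; first by rewrite subn0.
rewrite iterSr; have -> : (code_cons x c)./2 = code_cons x.-1 c.
  by case: x kx => // x _; rewrite /code_cons expnS -mulnA mul2n doubleK.
by rewrite IH; [congr code_cons; lia|lia].
Qed.

Definition code_head n := head 0 (CodeSeq.decode n).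
Definition code_tail n := CodeSeq.code (behead (CodeSeq.decode n)).

Lemma code_cases n : n = 0 \/ exists x s, n = code_cons x (CodeSeq.code s) /\
  CodeSeq.decode n = x :: s.
Proof.
rewrite -{1 2}(CodeSeq.decodeK n).
by case: (CodeSeq.decode n) => [|x s]; [left|right; exists x, s].
Qed.

(** The head is the exponent of 2 in [n], thus the least number of halvings that yields an odd
    number. The outer test handles the empty list, whose code 0 never becomes odd. *)
Lemma code_headP n (ex : exists k,
    (if (0 < n)%N then 1 - odd (iter k half n) else 0)%N == 0) :
  ex_minn ex = code_head n.
Proof.
rewrite /code_head; case: ex_minnP => k.
have [->|[x [s [nE ->]]]] := code_cases n.
  by move=> _ /(_ 0 isT); rewrite leqn0 => /eqP.
have -> : (0 < n)%N by rewrite nE muln_gt0 expn_gt0.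
move=> /= kP /(_ x); rewrite nE iter_half_code_cons// subnn.
rewrite {1}/code_cons mul1n /= odd_double => /(_ isT) kx.
apply/eqP; rewrite eqn_leq kx leqNgt; apply/negP => xk.
move: kP; rewrite nE iter_half_code_cons; last exact: ltnW.
by rewrite /code_cons -(subnSK xk) expnS -mulnA mul2n odd_double.
Qed.

Lemma rec_code_head : rec_fun1 code_head.
Proof.
pose F s := (if (0 < nth 0 s 1) then 1 - odd (iter (nth 0 s 0) half (nth 0 s 1))
  else 0)%N.
have Fr : rec_fun 2 F.
  apply: rec_if; [exact: rec_fun_proj| |exact: rec_fun_cst].
  apply: rec_fun2_comp rec_sub (rec_fun_cst _ _) _.
  by apply: rec_fun1_comp rec_odd _; exact: rec_iter_half.
have exF s : exists k, F (k :: s) == 0.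
  rewrite /F /=; have [->|[x [t [-> _]]]] := code_cases (nth 0 s 0).
    by exists 0.
  exists x; rewrite muln_gt0 expn_gt0 /=.
  by rewrite iter_half_code_cons// subnn /code_cons mul1n /= odd_double.
apply: rec_fun_ext (rec_fun_mu exF Fr) => s _.
by rewrite -(code_headP (exF s)).
Qed.

(** For a nonempty list, as many halvings as the head says leave [c.*2.+1]; one more leaves the code
    [c] of the tail. *)
Lemma code_tailE n : code_tail n = iter (code_head n).+1 half n.
Proof.
rewrite /code_tail /code_head.
have [->//|[x [s [nE ->]]]] := code_cases n.
rewrite nE iterS iter_half_code_cons// subnn /code_cons mul1n /=.
by rewrite uphalf_double.
Qed.

Lemma rec_code_tail : rec_fun1 code_tail.
Proof.
apply: rec_fun_ext (rec_fun2_comp rec_iter_half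
  (rec_fun_succ (rec_fun1_comp rec_code_head (rec_fun_proj 1 0)))
  (rec_fun_proj 1 0)) => s _.
by rewrite code_tailE.
Qed.

(** * Computable functions between numbered types *)

(** Only surjectivity is asked: a rational, for instance, has many numbers. *)
Class numbering (A : Type) := Numbering {
  of_num : nat -> A ;
  of_num_surj : forall a, exists n, of_num n = a }.

Definition code_pair m n := code_cons m (code_cons n 0).

Lemma code_pairE m n : code_pair m n = CodeSeq.code [:: m; n].
Proof. by []. Qed.

Lemma head_pair m n : code_head (code_pair m n) = m.
Proof. by rewrite code_pairE /code_head CodeSeq.codeK. Qed.

Lemma tail_pair m n : code_head (code_tail (code_pair m n)) = n.
Proof. by rewrite code_pairE /code_head /code_tail !CodeSeq.codeK. Qed.

#[global] Instance nat_numbering : numbering nat.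
Proof. by exists id => n; exists n. Defined.

#[global] Instance bool_numbering : numbering bool.
Proof. by exists (fun n => (0 < n)%N) => -[]; [exists 1|exists 0]. Defined.

#[global] Instance prod_numbering A B (nA : numbering A) (nB : numbering B) :
  numbering (A * B).
Proof.
exists (fun n => (of_num (code_head n), of_num (code_head (code_tail n))))
  => -[a b].
have [m ma] := of_num_surj a; have [n nb] := of_num_surj b.
by exists (code_pair m n); rewrite head_pair tail_pair ma nb.
Defined.

#[global] Instance seq_numbering A (nA : numbering A) : numbering (seq A).
Proof.
exists (fun n => map of_num (CodeSeq.decode n)) => s.
have [t ts] : exists t, map of_num t = s.
  elim: s => [|a s [t ts]]; first by exists [::].
  by have [n na] := of_num_surj a; exists (n :: t); rewrite -na -ts.
by exists (CodeSeq.code t); rewrite CodeSeq.codeK.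
Defined.

#[global] Instance rat_numbering : numbering rat :=
  {| of_num := decode_rat; of_num_surj := decode_rat_surj |}.

Definition cfun A B (nA : numbering A) (nB : numbering B) (f : A -> B) :=
  exists2 g, rec_fun1 g & forall n, of_num (g n) = f (of_num n).
Arguments cfun {A B nA nB} f.

Section closure.
Context {X A B C : Type} {nX : numbering X} {nA : numbering A}
  {nB : numbering B} {nC : numbering C}.

Lemma cfun_ext (f g : X -> A) : f =1 g -> cfun f -> cfun g.
Proof. by move=> fg [h hr hf]; exists h => // n; rewrite hf fg. Qed.

Lemma cfun_id : cfun (@id X).
Proof. by exists id => //; exact: rec_fun_proj. Qed.

Lemma cfun_cst (a : A) : cfun (fun _ : X => a).
Proof.
have [n na] := of_num_surj a; exists (fun=> n) => //; exact: rec_fun_cst.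
Qed.

Lemma cfun_num (f : X -> nat) : cfun f -> cfun (fun x => of_num (f x) : A).
Proof. by case=> g gr gf; exists g => // n; rewrite -gf. Qed.

Lemma cfun_comp (g : A -> B) (f : X -> A) :
  cfun g -> cfun f -> cfun (fun x => g (f x)).
Proof.
move=> [g' g'r g'g] [f' f'r f'f]; exists (g' \o f') => [|n].
  exact: rec_fun1_comp g'r f'r.
by rewrite /= g'g f'f.
Qed.

(** A pair of numbers and the pair of elements that they denote have the same number. The
    computation may therefore inspect the numbers, such as an unreduced numerator, which is no
    function of the element. *)
Lemma cfun_code2 (F : nat * nat -> C) (f : A * B -> C) :
  (forall m n, F (m, n) = f (of_num m, of_num n)) -> cfun F -> cfun f.
Proof. by move=> Ff [g gr gF]; exists g => // n; rewrite gF Ff. Qed.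

Lemma cfun_pair (f : X -> A) (g : X -> B) :
  cfun f -> cfun g -> cfun (fun x => (f x, g x)).
Proof.
move=> [f' f'r f'f] [g' g'r g'g]; exists (fun n => code_pair (f' n) (g' n)).
  apply: rec_fun2_comp rec_code_cons f'r _.
  exact: rec_fun2_comp rec_code_cons g'r (rec_fun_cst _ _).
by move=> n /=; rewrite head_pair tail_pair f'f g'g.
Qed.

Lemma cfun_fst (f : X -> A * B) : cfun f -> cfun (fun x => (f x).1).
Proof.
move=> [f' f'r f'f]; exists (fun n => code_head (f' n)).
  exact: rec_fun1_comp rec_code_head f'r.
by move=> n /=; rewrite -f'f.
Qed.

Lemma cfun_snd (f : X -> A * B) : cfun f -> cfun (fun x => (f x).2).
Proof.
move=> [f' f'r f'f]; exists (fun n => code_head (code_tail (f' n))).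
  exact: rec_fun1_comp rec_code_head (rec_fun1_comp rec_code_tail f'r).
by move=> n /=; rewrite -f'f.
Qed.

Lemma cfun_if (b : X -> bool) (f g : X -> A) :
  cfun b -> cfun f -> cfun g -> cfun (fun x => if b x then f x else g x).
Proof.
move=> [b' b'r b'b] [f' f'r f'f] [g' g'r g'g].
exists (fun n => if (0 < b' n)%N then f' n else g' n); first exact: rec_if.
by move=> n; rewrite -f'f -g'g -b'b /=; case: ifP.
Qed.

Lemma cfun_iter (k : X -> nat) (a : X -> A) (f : X * A -> A) :
  cfun k -> cfun a -> cfun f ->
  cfun (fun x => iter (k x) (fun a => f (x, a)) (a x)).
Proof.
move=> [k' k'r k'k] [a' a'r a'a] [f' f'r f'f].
pose r m n := iter m (fun w => f' (code_pair n w)) (a' n).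
have rr : rec_fun2 r.
  pose G s := f' (code_pair (nth 0 s 2) (nth 0 s 1)).
  have Gr : rec_fun 3 G.
    apply: rec_fun1_comp f'r _; apply: rec_fun2_comp rec_code_cons _ _.
      exact: rec_fun_proj.
    exact: rec_fun2_comp rec_code_cons (rec_fun_proj _ _) (rec_fun_cst _ _).
  apply: rec_fun_ext (rec_fun_rec a'r Gr) => -[|m [|n []]]//= _.
exists (fun n => r (k' n) n).
  exact: rec_fun2_comp rr k'r (rec_fun_proj _ _).
move=> n; rewrite -k'k /= -a'a /r; elim: (k' n) => //= m <-.
by rewrite f'f /= head_pair tail_pair.
Qed.

Lemma cfun_nat1 (f : nat -> nat) (F : X -> nat) :
  rec_fun1 f -> cfun F -> cfun (fun x => f (F x)).
Proof.
move=> fr [F' F'r F'F]; exists (fun n => f (F' n)).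
  exact: rec_fun1_comp fr F'r.
by move=> n /=; rewrite -F'F.
Qed.

Lemma cfun_nat2 (f : nat -> nat -> nat) (F G : X -> nat) :
  rec_fun2 f -> cfun F -> cfun G -> cfun (fun x => f (F x) (G x)).
Proof.
move=> fr [F' F'r F'F] [G' G'r G'G]; exists (fun n => f (F' n) (G' n)).
  exact: rec_fun2_comp fr F'r G'r.
by move=> n /=; rewrite -F'F -G'G.
Qed.

Lemma cfun_ltn (F G : X -> nat) :
  cfun F -> cfun G -> cfun (fun x => F x < G x)%N.
Proof.
move=> [F' F'r F'F] [G' G'r G'G]; exists (fun n => G' n - F' n)%N.
  exact: rec_fun2_comp rec_sub G'r F'r.
by move=> n /=; rewrite -F'F -G'G subn_gt0.
Qed.

(* The witness is the one of least number, so that it does not depend on the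
number by which [x] is given. *)
Lemma cfun_search (p : X * A -> bool) :
  cfun p -> (forall x, exists a, p (x, a)) ->
  exists2 h : X -> A, cfun h & forall x, p (x, h x).
Proof.
move=> [p' p'r p'p] exp.
have exn x : exists n, p (x, of_num n).
  by have [a xa] := exp x; have [n na] := of_num_surj a; exists n; rewrite na.
exists (fun x => of_num (ex_minn (exn x))); last first.
  by move=> x; case: ex_minnP.
pose F s := (if (0 < p' (code_pair (nth 0 s 1) (nth 0 s 0))) then 0 else 1)%N.
have pF k n : p (of_num n, of_num k) = (F [:: k; n] == 0).
  rewrite /F /=; transitivity (of_num (p' (code_pair n k)) : bool).
    by rewrite p'p /= head_pair tail_pair.
  by rewrite /=; case: ifP.
have Fr : rec_fun 2 F.
  apply: rec_if; try exact: rec_fun_cst.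
  apply: rec_fun1_comp p'r _; apply: rec_fun2_comp rec_code_cons _ _.
    exact: rec_fun_proj.
  exact: rec_fun2_comp rec_code_cons (rec_fun_proj _ _) (rec_fun_cst _ _).
have exF s : exists k, F (k :: s) == 0.
  by have [k kp] := exn (of_num (nth 0 s 0)); exists k; rewrite /F /= -pF.
exists (fun n => ex_minn (exF [:: n])).
  apply: rec_fun_ext (rec_fun_mu exF Fr) => -[|n []]//= _.
(* Both sides are the least elements of the same set of numbers, by [pF]. *)
move=> n; congr of_num; apply/eqP; rewrite eqn_leq.
case: ex_minnP => k; rewrite -pF => pk mk; case: ex_minnP => l.
by rewrite pF => pl ml; rewrite mk// ml// pF.
Qed.

Lemma cfun_cons (f : X -> A) (s : X -> seq A) :
  cfun f -> cfun s -> cfun (fun x => f x :: s x).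
Proof.
move=> [f' f'r f'f] [s' s'r s's]; exists (fun n => code_cons (f' n) (s' n)).
  exact: rec_fun2_comp rec_code_cons f'r s'r.
move=> n; rewrite -f'f -s's /= -{1}(CodeSeq.decodeK (s' n)).
by rewrite -[code_cons _ _]/(CodeSeq.code (_ :: _)) CodeSeq.codeK.
Qed.

Lemma cfun_nilp (s : X -> seq A) : cfun s -> cfun (fun x => nilp (s x)).
Proof.
move=> [s' s'r s's]; exists (fun n => if (0 < s' n)%N then 0 else 1).
  apply: rec_if => //; exact: rec_fun_cst.
move=> n; rewrite -s's /= /nilp size_map.
have [->//|[x [t [-> ->]]]] := code_cases (s' n).
by rewrite muln_gt0 expn_gt0.
Qed.

(** The default is [of_num 0] because the code 0 of the empty list has head 0. *)
Lemma cfun_head (s : X -> seq A) : cfun s ->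
  cfun (fun x => head (of_num 0) (s x)).
Proof.
move=> [s' s'r s's]; exists (fun n => code_head (s' n)).
  exact: rec_fun1_comp rec_code_head s'r.
by move=> n; rewrite -s's /= /code_head; case: (CodeSeq.decode _).
Qed.

Lemma cfun_behead (s : X -> seq A) : cfun s -> cfun (fun x => behead (s x)).
Proof.
move=> [s' s'r s's]; exists (fun n => code_tail (s' n)).
  exact: rec_fun1_comp rec_code_tail s'r.
by move=> n; rewrite -s's /= /code_tail CodeSeq.codeK behead_map.
Qed.

End closure.

(** * Computability of folds over lists *)

Section fold.
Context {X A C : Type} {nX : numbering X} {nA : numbering A} {nC : numbering C}.

Lemma iter_behead k (s : seq C) : iter k behead s = drop k s.
Proof.
elim: k => [|k IH]; first by rewrite drop0.
by rewrite iterS IH -drop1 drop_drop add1n.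
Qed.

(** Iteration needs a number of rounds known in advance; a search finds a number of removals of the
    head that empties the list. *)
Lemma cfun_size_bound :
  exists2 h : seq C -> nat, cfun h & forall s, (size s <= h s)%N.
Proof.
pose p (x : seq C * nat) := nilp (iter x.2 (fun t => behead (x, t).2) x.1).
have [|s|h hc hP] := @cfun_search _ _ _ _ p.
- apply: cfun_nilp; apply: (cfun_iter (f := fun y : _ * seq C => behead y.2)).
  + exact/cfun_snd/cfun_id.
  + exact/cfun_fst/cfun_id.
  + exact/cfun_behead/cfun_snd/cfun_id.
- by exists (size s); rewrite /p /= iter_behead drop_size.
- exists h => // s; have := hP s; rewrite /p /= iter_behead /nilp size_drop.
  by rewrite subn_eq0.
Qed.

Lemma cfun_foldl (f : X * (A * C) -> A) (a : X -> A) (s : X -> seq C) :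
  cfun f -> cfun a -> cfun s ->
  cfun (fun x => foldl (fun a c => f (x, (a, c))) (a x) (s x)).
Proof.
move=> fc ac sc; have [h hc hP] := cfun_size_bound.
(* The state is the accumulator with the remaining list; [step] is idle on an empty list, so that
   surplus rounds do no harm. *)
pose step (y : X * (A * seq C)) :=
  if nilp y.2.2 then y.2
  else (f (y.1, (y.2.1, head (@of_num _ nC 0) y.2.2)), behead y.2.2).
have stepc : cfun step.
  have y2 : cfun (fun y : X * (A * seq C) => y.2) by exact/cfun_snd/cfun_id.
  rewrite /step; apply: cfun_if => //; first exact/cfun_nilp/cfun_snd.
  apply: cfun_pair; last exact/cfun_behead/cfun_snd.
  apply: cfun_comp fc _; apply: cfun_pair; first exact/cfun_fst/cfun_id.
  by apply: cfun_pair; [exact: cfun_fst|exact/cfun_head/cfun_snd].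
pose r x := iter (h (s x)) (fun w => step (x, w)) (a x, s x).
apply: (@cfun_ext _ _ _ _ (fun x => (r x).1)); last first.
  by apply: cfun_fst; apply: cfun_iter => //; [exact: cfun_comp|exact: cfun_pair].
move=> x; rewrite /r; have := hP (s x).
elim: (s x) (a x) (h (s x)) => [a0 k _|c t IH a0 [//|k] sk].
  by have -> : iter k (fun w => step (x, w)) (a0, [::]) = (a0, [::])
    by elim: k => //= k ->.
by rewrite iterSr /= IH.
Qed.

End fold.

Lemma cfun_foldr X A C (nX : numbering X) (nA : numbering A) (nC : numbering C)
    (f : X * (C * A) -> A) (a : X -> A) (s : X -> seq C) :
  cfun f -> cfun a -> cfun s ->
  cfun (fun x => foldr (fun c a => f (x, (c, a))) (a x) (s x)).
Proof.
move=> fc ac sc.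
have rc : cfun (fun x => rev (s x)).
  apply: (@cfun_ext _ _ _ _ (fun x => foldl (fun t c => c :: t) [::] (s x))).
    by move=> x; rewrite /rev; elim: (s x) [::] => //= c t IH u; rewrite IH.
  apply: (cfun_foldl (f := fun y : X * (seq C * C) => y.2.2 :: y.2.1)) => //.
    by apply: cfun_cons; [apply: cfun_snd|apply: cfun_fst];
      exact/cfun_snd/cfun_id.
  exact: cfun_cst.
apply: (@cfun_ext _ _ _ _
    (fun x => foldl (fun a c => f (x, (c, a))) (a x) (rev (s x)))) => [x|].
  by rewrite foldl_rev.
apply: (cfun_foldl (f := fun y : X * (A * C) => f (y.1, (y.2.2, y.2.1)))) => //.
apply: cfun_comp fc _; apply: cfun_pair; first exact/cfun_fst/cfun_id.
by apply: cfun_pair; [apply: cfun_snd|apply: cfun_fst]; exact/cfun_snd/cfun_id.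
Qed.

Lemma cfun_all X C (nX : numbering X) (nC : numbering C)
    (p : X * C -> bool) (s : X -> seq C) :
  cfun p -> cfun s -> cfun (fun x => all (fun c => p (x, c)) (s x)).
Proof.
move=> pc sc.
apply: (cfun_foldr
  (f := fun y : X * (C * bool) => if p (y.1, y.2.1) then y.2.2 else false)) => //.
  apply: cfun_if; [|exact/cfun_snd/cfun_snd/cfun_id|exact: cfun_cst].
  apply: cfun_comp pc _; apply: cfun_pair; first exact/cfun_fst/cfun_id.
  exact/cfun_fst/cfun_snd/cfun_id.
exact: cfun_cst.
Qed.

Lemma cfun_has X C (nX : numbering X) (nC : numbering C)
    (p : X * C -> bool) (s : X -> seq C) :
  cfun p -> cfun s -> cfun (fun x => has (fun c => p (x, c)) (s x)).
Proof.
move=> pc sc.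
apply: (cfun_foldr
  (f := fun y : X * (C * bool) => if p (y.1, y.2.1) then true else y.2.2)) => //.
  apply: cfun_if; [|exact: cfun_cst|exact/cfun_snd/cfun_snd/cfun_id].
  apply: cfun_comp pc _; apply: cfun_pair; first exact/cfun_fst/cfun_id.
  exact/cfun_fst/cfun_snd/cfun_id.
exact: cfun_cst.
Qed.

(** * Rational arithmetic *)

Section rational_arithmetic.
Context {X : Type} {nX : numbering X}.
Local Open Scope ring_scope.

Definition rat_of_nats (a b c : nat) : rat := (a%:Q - b%:Q) / c.+1%:Q.

Lemma cfun_rat_of_nats (a b c : X -> nat) : cfun a -> cfun b -> cfun c ->
  cfun (fun x => rat_of_nats (a x) (b x) (c x)).
Proof.
move=> [a' a'r a'a] [b' b'r b'b] [c' c'r c'c].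
exists (fun n => code_cons (a' n) (code_pair (b' n) (c' n))).
  do 3![apply: (rec_fun2_comp rec_code_cons) => //]; exact: rec_fun_cst.
move=> n; rewrite -a'a -b'b -c'c -[of_num _]/(decode_rat _).
rewrite -[code_cons _ _]/(CodeSeq.code [:: a' n; b' n; c' n]).
by rewrite /decode_rat CodeSeq.codeK.
Qed.

Let p n := code_head n.
Let q n := code_head (code_tail n).
Let d n := code_head (code_tail (code_tail n)).

Lemma decode_ratE n : decode_rat n = rat_of_nats (p n) (q n) (d n).
Proof.
rewrite /p /q /d /code_tail /code_head !CodeSeq.codeK /decode_rat.
by case: (CodeSeq.decode n) => [|a [|b [|c s]]].
Qed.

Lemma cfun_components (f : X -> nat) : cfun f ->
  [/\ cfun (fun x => p (f x)), cfun (fun x => q (f x)) &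
      cfun (fun x => d (f x))].
Proof.
move=> fc; split; do ?exact: (cfun_nat1 rec_code_head);
  by do ?[apply: (cfun_nat1 rec_code_head)|apply: (cfun_nat1 rec_code_tail)].
Qed.
End rational_arithmetic.

Section rational_operations.
Context {X : Type} {nX : numbering X}.
Local Open Scope ring_scope.
Implicit Types f g : X -> rat.

Let p n := code_head n.
Let q n := code_head (code_tail n).
Let d n := code_head (code_tail (code_tail n)).

Let comp1 : [/\ cfun (fun y : nat * nat => p y.1),
  cfun (fun y : nat * nat => q y.1) & cfun (fun y : nat * nat => d y.1)].
Proof. exact/cfun_components/cfun_fst/cfun_id. Qed.

Let comp2 : [/\ cfun (fun y : nat * nat => p y.2),
  cfun (fun y : nat * nat => q y.2) & cfun (fun y : nat * nat => d y.2)].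
Proof. exact/cfun_components/cfun_snd/cfun_id. Qed.

Let denominator_neq0 n : n.+1%:Q != 0 :> rat.
Proof. by rewrite intr_eq0. Qed.

(** Fractions are added without reduction, positive and negative parts of the numerators separately.
    The last entry is the product of the denominators minus 1, as the decoder adds 1 to it. *)
Lemma cfun_addr f g : cfun f -> cfun g -> cfun (fun x => f x + g x).
Proof.
move=> fc gc; have [p1 q1 d1] := comp1; have [p2 q2 d2] := comp2.
apply: (cfun_comp (g := fun y : rat * rat => y.1 + y.2)
  (f := fun x => (f x, g x))); last exact: cfun_pair.
apply: (cfun_code2 (F := fun y => rat_of_nats
  (p y.1 * (d y.2).+1 + p y.2 * (d y.1).+1)
  (q y.1 * (d y.2).+1 + q y.2 * (d y.1).+1)
  (d y.1 * (d y.2).+1 + d y.2))) => [m n|].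
  rewrite /= !decode_ratE.
  rewrite -/(p m) -/(q m) -/(d m) -/(p n) -/(q n) -/(d n) /rat_of_nats.
  have -> : (d m * (d n).+1 + d n).+1 = ((d m).+1 * (d n).+1)%N by lia.
  rewrite !PoszD !PoszM !rmorphD !rmorphM /=.
  move: (denominator_neq0 (d m)) (denominator_neq0 (d n)).
  move: ((d m).+1%:Q) ((d n).+1%:Q) => u v u0 v0.
  by field; rewrite u0 v0.
by apply: cfun_rat_of_nats; do ?[apply: (cfun_nat2 rec_add) => //
  |apply: (cfun_nat2 rec_mul) => //
  |apply: (cfun_nat1 (f := succn) (rec_fun_succ (rec_fun_proj 1 0)))].
Qed.

Lemma cfun_mulr f g : cfun f -> cfun g -> cfun (fun x => f x * g x).
Proof.
move=> fc gc; have [p1 q1 d1] := comp1; have [p2 q2 d2] := comp2.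
apply: (cfun_comp (g := fun y : rat * rat => y.1 * y.2)
  (f := fun x => (f x, g x))); last exact: cfun_pair.
apply: (cfun_code2 (F := fun y => rat_of_nats
  (p y.1 * p y.2 + q y.1 * q y.2) (p y.1 * q y.2 + q y.1 * p y.2)
  (d y.1 * (d y.2).+1 + d y.2))) => [m n|].
  rewrite /= !decode_ratE.
  rewrite -/(p m) -/(q m) -/(d m) -/(p n) -/(q n) -/(d n) /rat_of_nats.
  have -> : (d m * (d n).+1 + d n).+1 = ((d m).+1 * (d n).+1)%N by lia.
  rewrite !PoszD !PoszM !rmorphD !rmorphM /=.
  move: (denominator_neq0 (d m)) (denominator_neq0 (d n)).
  move: ((d m).+1%:Q) ((d n).+1%:Q) => u v u0 v0.
  by field; rewrite u0 v0.
by apply: cfun_rat_of_nats; do ?[apply: (cfun_nat2 rec_add) => //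
  |apply: (cfun_nat2 rec_mul) => //
  |apply: (cfun_nat1 (f := succn) (rec_fun_succ (rec_fun_proj 1 0)))].
Qed.

Lemma cfun_oppr f : cfun f -> cfun (fun x => - f x).
Proof.
move=> fc; apply: (@cfun_ext _ _ _ _ (fun x => -1 * f x)).
  by move=> x; rewrite mulN1r.
by apply: cfun_mulr => //; exact: cfun_cst.
Qed.

(** After cross-multiplication the subtracted terms change sides, which leaves a comparison of
    natural numbers. *)
Lemma cfun_ltr f g : cfun f -> cfun g -> cfun (fun x => f x < g x).
Proof.
move=> fc gc; have [p1 q1 d1] := comp1; have [p2 q2 d2] := comp2.
apply: (cfun_comp (g := fun y : rat * rat => y.1 < y.2)
  (f := fun x => (f x, g x))); last exact: cfun_pair.
apply: (cfun_code2 (F := fun y =>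
  (p y.1 * (d y.2).+1 + q y.2 * (d y.1).+1
     < p y.2 * (d y.1).+1 + q y.1 * (d y.2).+1)%N)) => [m n|].
  rewrite /= !decode_ratE.
  rewrite -/(p m) -/(q m) -/(d m) -/(p n) -/(q n) -/(d n) /rat_of_nats.
  have d0 k : 0 < (d k).+1%:Q :> rat by rewrite ltr0z.
  rewrite ltr_pdivrMr// mulrAC ltr_pdivlMr// -ltz_nat -(ltr_int rat).
  rewrite !PoszD !PoszM !rmorphD !rmorphM /=.
  by apply/idP/idP; nra.
by apply: cfun_ltn; do ?[apply: (cfun_nat2 rec_add) => //
  |apply: (cfun_nat2 rec_mul) => //
  |apply: (cfun_nat1 (f := succn) (rec_fun_succ (rec_fun_proj 1 0)))].
Qed.

Lemma cfun_minr f g : cfun f -> cfun g -> cfun (fun x => Order.min (f x) (g x)).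
Proof. by move=> fc gc; apply: cfun_if => //; exact: cfun_ltr. Qed.

Lemma cfun_normr f : cfun f -> cfun (fun x => `|f x|).
Proof.
move=> fc; apply: (@cfun_ext _ _ _ _
  (fun x => if 0 < f x then f x else - f x)).
  by move=> x; case: ltP => h; [rewrite gtr0_norm|rewrite ler0_norm].
apply: cfun_if => //; last exact: cfun_oppr.
by apply: cfun_ltr => //; exact: cfun_cst.
Qed.

End rational_operations.

Lemma cfun_invpow2 X (nX : numbering X) (f : X -> nat) : cfun f ->
  cfun (fun x => 2^-1 ^+ f x : rat)%R.
Proof.
move=> fc; apply: (@cfun_ext _ _ _ _
  (fun x => iter (f x) (fun a => (fun y : X * rat => 2^-1 * y.2)%R (x, a)) 1%R)).
  by move=> x; elim: (f x) => //= k ->; rewrite exprS.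
apply: (cfun_iter (f := fun y : X * rat => (2^-1 * y.2)%R)) => //.
  exact: cfun_cst.
by apply: cfun_mulr; [exact: cfun_cst|exact/cfun_snd/cfun_id].
Qed.

(** * Programs *)

(** Since [no_oracle] answers 0 everywhere, replacing queries by [Zero] preserves the oracle-free
    computations and makes them valid for every oracle. *)
Fixpoint strip (c : Defs.code) : Defs.code :=
  match c with
  | Oracle => Zero
  | Comp f gs => Comp (strip f) (map strip gs)
  | PrimRec f g => PrimRec (strip f) (strip g)
  | Mu f => Mu (strip f)
  | c => c
  end.

Lemma eval_strip o c s v : eval no_oracle c s v -> eval o (strip c) s v.
Proof.
elim=> {c s v} /=; try by constructor.
- move=> f gs s ts v sz _ IH _ IHf; apply: eval_comp IHf.
    by rewrite sz size_map.
  rewrite size_map => i igs; have := IH _ igs.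
  by rewrite (nth_map Zero).
- by move=> f g n s w v _ IH _ IHg; exact: eval_recS IH IHg.
- move=> f s n w _ IH _ IHm; exact: eval_mu IH IHm.
Qed.

Lemma cfun_computable1 f : computable1 f -> cfun f.
Proof.
move=> [c cf]; exists f => //; exists (strip c) => o [|n []]//= _.
exact: eval_strip.
Qed.

Lemma cfun_computable3 f : computable3 f ->
  cfun (fun x : nat * (nat * nat) => f x.1 x.2.1 x.2.2).
Proof.
move=> [c cf].
pose g n := f (code_head n) (code_head (code_head (code_tail n)))
  (code_head (code_tail (code_head (code_tail n)))).
exists g => //.
pose F s := f (nth 0 s 0) (nth 0 s 1) (nth 0 s 2).
have Fr : rec_fun 3 F.
  by exists (strip c) => o [|i [|j [|k []]]]//= _; exact: eval_strip.
pose G1 (s : seq nat) := code_head (nth 0 s 0).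
pose G2 (s : seq nat) := code_head (code_head (code_tail (nth 0 s 0))).
pose G3 (s : seq nat) :=
  code_head (code_tail (code_head (code_tail (nth 0 s 0)))).
apply: (@rec_fun_comp 1 F [:: G1; G2; G3] Fr).
do 3![apply: rec_funs_cons; first by
  do ?[exact: rec_fun_proj|apply: (rec_fun1_comp rec_code_head)
      |apply: (rec_fun1_comp rec_code_tail)]].
exact: rec_funs_nil.
Qed.

Lemma computable2_cfun B (nB : numbering B) (f : nat * nat -> B) : cfun f ->
  exists2 g, computable2 g & forall i j, of_num (g i j) = f (i, j).
Proof.
move=> [g gr gf]; exists (fun i j => g (code_pair i j)); last first.
  by move=> i j; rewrite gf /= head_pair tail_pair.
have [c cP] : rec_fun 2 (fun s => g (code_pair (nth 0 s 0) (nth 0 s 1))).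
  apply: rec_fun1_comp gr _; apply: rec_fun2_comp rec_code_cons _ _.
    exact: rec_fun_proj.
  exact: rec_fun2_comp rec_code_cons (rec_fun_proj _ _) (rec_fun_cst _ _).
by exists c => i j; exact: cP.
Qed.

(** A single entry of the name is consulted, that of index [k.+1]: its error takes half of the
    admissible [2 ^- k] and leaves the other half to [f]. *)
Lemma oracle_cfun B (nB : numbering B) (f : nat * (nat * nat) -> B) : cfun f ->
  exists2 g : nat -> nat -> nat -> nat,
    exists c, forall nu n k, eval nu c [:: n; k] (g (nu k.+1) n k) &
    forall m n k, of_num (g m n k) = f (m, (n, k)).
Proof.
move=> [g gr gf]; exists (fun m n k => g (code_pair m (code_pair n k))); last first.
  by move=> m n k; rewrite gf /= !(head_pair, tail_pair).
pose F s := g (code_pair (nth 0 s 0) (code_pair (nth 0 s 1) (nth 0 s 2))).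
have [c cP] : rec_fun 3 F.
  apply: rec_fun1_comp gr _.
  by do ?[apply: (rec_fun2_comp rec_code_cons)|exact: rec_fun_proj
    |exact: rec_fun_cst].
exists (Comp c [:: Comp Oracle [:: Comp Succ [:: Proj 1]]; Proj 0; Proj 1]).
move=> nu n k; apply: (eval_comp (ts := [:: nu k.+1; n; k])) => //; last exact: cP.
have succk : eval nu (Comp Succ [:: Proj 1]) [:: n; k] k.+1.
  apply: (eval_comp (ts := [:: k])) => [//|[|//] _|].
    exact: (eval_proj _ 1).
  exact: (eval_succ _ [:: k]).
move=> [|[|[|//]]] _ /=; last 2 first.
- exact: (eval_proj _ 0).
- exact: (eval_proj _ 1).
apply: (eval_comp (ts := [:: k.+1])) => [//|[|//] _ //|].
exact: (eval_oracle _ [:: k.+1]).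
Qed.

(** * Ball arithmetic *)

Local Open Scope ring_scope.

(** Center and radius of a closed interval. *)
Definition rat_ball := (rat * rat)%type.

Definition ball_cst (q : rat) : rat_ball := (q, 0).
Definition ball_add (b c : rat_ball) : rat_ball := (b.1 + c.1, b.2 + c.2).
(** The radius bounds the error terms in (b + s)(c + t) - bc = bt + cs + st. *)
Definition ball_mul (b c : rat_ball) : rat_ball :=
  (b.1 * c.1, `|b.1| * c.2 + `|c.1| * b.2 + b.2 * c.2).
Definition ball_min (b c : rat_ball) : rat_ball := (Order.min b.1 c.1, b.2 + c.2).

Section enclosures.
Variable R : realType.

Definition in_ball (b : rat_ball) (y : R) := `|y - ratr b.1| <= ratr b.2.

Lemma in_ball_cst q : in_ball (ball_cst q) (ratr q).
Proof. by rewrite /in_ball subrr normr0 rmorph0. Qed.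

Lemma in_ball_add b c y z :
  in_ball b y -> in_ball c z -> in_ball (ball_add b c) (y + z).
Proof.
rewrite /in_ball /= !rmorphD/= opprD addrACA => by_ cz.
exact: le_trans (ler_normD _ _) (lerD by_ cz).
Qed.

Lemma in_ball_mul b c y z :
  in_ball b y -> in_ball c z -> in_ball (ball_mul b c) (y * z).
Proof.
rewrite /in_ball /= !rmorphD/= !rmorphM/= !ratr_norm => by_ cz.
have -> : y * z - ratr b.1 * ratr c.1 = ratr b.1 * (z - ratr c.1) +
    ratr c.1 * (y - ratr b.1) + (y - ratr b.1) * (z - ratr c.1) by ring.
apply: le_trans (ler_normD _ _) _; apply: lerD; last first.
  by rewrite normrM ler_pM.
apply: le_trans (ler_normD _ _) _; rewrite !normrM.
by apply: lerD; rewrite ler_wpM2l.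
Qed.

(** A minimum changes by no more than the larger change of its two arguments, hence by no more than
    the sum of the radii. *)
Lemma in_ball_min b c y z :
  in_ball b y -> in_ball c z -> in_ball (ball_min b c) (Order.min y z).
Proof.
rewrite /in_ball /= rmorphD/= => by_ cz.
have -> : ratr (Order.min b.1 c.1) = Order.min (ratr b.1) (ratr c.1) :> R.
  by rewrite /Order.min ltr_rat; case: ifP.
(* A ball that contains a point has nonnegative radius. *)
have b0 := le_trans (normr_ge0 _) by_; have c0 := le_trans (normr_ge0 _) cz.
move: by_ cz; rewrite !ler_norml => /andP[? ?] /andP[? ?].
by case: (leP y z); case: (leP (ratr b.1 : R) (ratr c.1)) => ? ?; lra.
Qed.

End enclosures.

(* For a family of balls indexed by precisions [e], the same [C] for all [e]
means that the radii tend to 0 with [e] while the centers stay bounded. *)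
Definition ball_le (C e : rat) (b : rat_ball) :=
  [/\ `|b.1| <= C, 0 <= b.2 & b.2 <= C * e].

Section ball_le.
Variable e : rat.
Hypotheses (e0 : 0 <= e) (e1 : e <= 1).

Lemma ball_le_cst q : ball_le `|q| e (ball_cst q).
Proof. by split=> //=; rewrite mulr_ge0. Qed.

Lemma ball_le_add C D b c :
  ball_le C e b -> ball_le D e c -> ball_le (C + D) e (ball_add b c).
Proof.
move=> [b1 b0 b2] [c1 c0 c2]; split => /=; last 2 first.
- exact: addr_ge0.
- by rewrite mulrDl lerD.
- exact: le_trans (ler_normD _ _) (lerD b1 c1).
Qed.

Lemma ball_le_min C D b c :
  ball_le C e b -> ball_le D e c -> ball_le (C + D) e (ball_min b c).
Proof.
move=> [b1 b0 b2] [c1 c0 c2]; split => /=; last 2 first.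
- exact: addr_ge0.
- by rewrite mulrDl lerD.
- have C0 := le_trans (normr_ge0 _) b1; have D0 := le_trans (normr_ge0 _) c1.
  by case: (leP b.1 c.1) => _; [apply: le_trans b1 _|apply: le_trans c1 _]; lra.
Qed.

(** Each of the three terms of the radius is at most [C * D * e]; for the product of the radii this
    uses [e <= 1]. *)
Lemma ball_le_mul C D b c :
  ball_le C e b -> ball_le D e c -> ball_le (3 * (C * D)) e (ball_mul b c).
Proof.
move=> [b1 b0 b2] [c1 c0 c2].
have C0 := le_trans (normr_ge0 _) b1; have D0 := le_trans (normr_ge0 _) c1.
have CD0 := mulr_ge0 C0 D0; split => /=.
- by rewrite normrM (le_trans (ler_pM _ _ b1 c1))//; lra.
- by rewrite !addr_ge0 ?mulr_ge0.
- have h1 : `|b.1| * c.2 <= C * (D * e) by rewrite ler_pM.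
  have h2 : `|c.1| * b.2 <= D * (C * e) by rewrite ler_pM.
  have h3 : b.2 * c.2 <= (C * e) * (D * e) by rewrite ler_pM.
  have h4 : (C * e) * (D * e) <= C * D * e.
    by rewrite mulrACA ler_wpM2l// ler_piMr.
  by rewrite (le_trans (lerD (lerD h1 h2) (le_trans h3 h4)))//; lra.
Qed.

End ball_le.

Section computable_balls.
Context {X : Type} {nX : numbering X}.
Implicit Types b c : X -> rat_ball.

Lemma cfun_ball_cst (q : X -> rat) : cfun q -> cfun (fun x => ball_cst (q x)).
Proof. by move=> qc; apply: cfun_pair => //; exact: cfun_cst. Qed.

Lemma cfun_ball_add b c :
  cfun b -> cfun c -> cfun (fun x => ball_add (b x) (c x)).
Proof.
by move=> bc cc; apply: cfun_pair; apply: cfun_addr;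
  do ?[exact: cfun_fst|exact: cfun_snd].
Qed.

Lemma cfun_ball_mul b c :
  cfun b -> cfun c -> cfun (fun x => ball_mul (b x) (c x)).
Proof.
by move=> bc cc; apply: cfun_pair; do ?[apply: cfun_addr|apply: cfun_mulr];
  do ?[apply: cfun_normr]; do ?[exact: cfun_fst|exact: cfun_snd].
Qed.

Lemma cfun_ball_min b c :
  cfun b -> cfun c -> cfun (fun x => ball_min (b x) (c x)).
Proof.
by move=> bc cc; apply: cfun_pair; [apply: cfun_minr|apply: cfun_addr];
  do ?[exact: cfun_fst|exact: cfun_snd].
Qed.

End computable_balls.

(** * Minima of affine functions of distances *)

(** An entry [(q, (L, k))] of the list stands for q + L d(p_k, -), the first component for the
    constant b. The distances enter later as [D]: real numbers in [min_eval], balls in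
    [min_ball]. *)
Definition min_form : Type := (rat * seq (rat * (rat * nat)))%type.

Definition min_eval (R : realType) (D : nat -> R) (g : min_form) : R :=
  foldr (fun t a => Order.min (ratr t.1 + ratr t.2.1 * D t.2.2) a)
    (ratr g.1) g.2.

Definition min_ball (D : nat -> rat_ball) (g : min_form) : rat_ball :=
  foldr (fun t a => ball_min
    (ball_add (ball_cst t.1) (ball_mul (ball_cst t.2.1) (D t.2.2))) a)
    (ball_cst g.1) g.2.

(** The parity of a letter marks the adjoint; it is dropped because the generators are
    real-valued. *)
Definition letter_form (l : nat) : min_form := of_num l./2.

Definition word_ball (D : nat -> rat_ball) (w : seq nat) : rat_ball :=
  foldr (fun l a => ball_mul (min_ball D (letter_form l)) a) (ball_cst 1) w.

Definition monomial_ball (D : nat -> rat_ball) (m : nat) : rat_ball * rat_ball :=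
  let s := CodeSeq.decode m in
  let b := word_ball D (behead s) in
  (ball_mul (ball_cst (decode_qi (head 0%N s)).1) b,
   ball_mul (ball_cst (decode_qi (head 0%N s)).2) b).

Definition poly_ball (D : nat -> rat_ball) (n : nat) : rat_ball * rat_ball :=
  foldr (fun m a => (ball_add (monomial_ball D m).1 a.1,
                     ball_add (monomial_ball D m).2 a.2))
    (ball_cst 0, ball_cst 0) (CodeSeq.decode n).

(** * Bounds on centers and radii, uniform in the precision *)

Lemma min_ball_le (C0 : rat) (g : min_form) : exists C, forall e D,
  0 <= e -> e <= 1 ->
  (forall i, ball_le C0 e (D i)) -> ball_le C e (min_ball D g).
Proof.
case: g => q s; elim: s => [|t s [C IH]].
  by exists `|q| => e D e0 e1 DC; exact: ball_le_cst.
exists (`|t.1| + 3 * (`|t.2.1| * C0) + C) => e D e0 e1 DC; rewrite /min_ball /=.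
apply: ball_le_min => //; last exact: IH.
apply: ball_le_add => //; first exact: ball_le_cst.
by apply: ball_le_mul => //; exact: ball_le_cst.
Qed.

Lemma word_ball_le (C0 : rat) (w : seq nat) : exists C, forall e D,
  0 <= e -> e <= 1 ->
  (forall i, ball_le C0 e (D i)) -> ball_le C e (word_ball D w).
Proof.
elim: w => [|l w [C IH]].
  by exists `|1| => e D e0 e1 DC; exact: ball_le_cst.
have [C' HC'] := min_ball_le C0 (letter_form l).
exists (3 * (C' * C)) => e D e0 e1 DC /=.
by apply: ball_le_mul => //; [exact: HC'|exact: IH].
Qed.

(** The constant depends on neither [e] nor [D]. The point p_k enters only through [D], so one
    precision will do for all [k]. *)
Lemma poly_ball_le (C0 : rat) (n : nat) : exists C, forall e D,
  0 <= e -> e <= 1 ->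
  (forall i, ball_le C0 e (D i)) ->
  ball_le C e (poly_ball D n).1 /\ ball_le C e (poly_ball D n).2.
Proof.
rewrite /poly_ball; elim: (CodeSeq.decode n) => [|m s [C IH]].
  exists 0 => e D e0 e1 DC /=.
  by rewrite -(normr0 rat); split; exact: ball_le_cst.
have [C' HC'] := word_ball_le C0 (behead (CodeSeq.decode m)).
pose q := decode_qi (head 0%N (CodeSeq.decode m)).
have weaken K L e b : 0 <= e -> K <= L -> ball_le K e b -> ball_le L e b.
  move=> e0 KL [b1 b0 b2]; split => //; first exact: le_trans KL.
  by rewrite (le_trans b2)// ler_wpM2r.
(* The sum of [|q.1|] and [|q.2|] bounds both parts of the coefficient, so that one constant serves
   the real and the imaginary ball. *)
exists (3 * ((`|q.1| + `|q.2|) * `|C'|) + C) => e D e0 e1 DC /=.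
have [ih1 ih2] := IH e D e0 e1 DC.
have wC : ball_le `|C'| e (word_ball D (behead (CodeSeq.decode m))).
  by apply: weaken (HC' e D e0 e1 DC) => //; exact: ler_norm.
by split; apply: ball_le_add => //; apply: ball_le_mul => //;
  apply: weaken (ball_le_cst e0 _) => //; rewrite ?lerDl ?lerDr.
Qed.

(** * Computability of the enclosures *)

Lemma cfun_min_ball X (nX : numbering X) (D : X * nat -> rat_ball)
    (g : X -> min_form) : cfun D -> cfun g ->
  cfun (fun x => min_ball (fun i => D (x, i)) (g x)).
Proof.
move=> cfunD gc; apply: (cfun_foldr
  (f := fun y : X * ((rat * (rat * nat)) * rat_ball) => ball_min
    (ball_add (ball_cst y.2.1.1)
      (ball_mul (ball_cst y.2.1.2.1) (D (y.1, y.2.1.2.2)))) y.2.2)).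
- have t : cfun (fun y : X * ((rat * (rat * nat)) * rat_ball) => y.2.1).
    exact/cfun_fst/cfun_snd/cfun_id.
  apply: cfun_ball_min; last exact/cfun_snd/cfun_snd/cfun_id.
  apply: cfun_ball_add; first exact/cfun_ball_cst/cfun_fst.
  apply: cfun_ball_mul; first exact/cfun_ball_cst/cfun_fst/cfun_snd.
  apply: cfun_comp cfunD _; apply: cfun_pair; first exact/cfun_fst/cfun_id.
  exact/cfun_snd/cfun_snd.
- exact/cfun_ball_cst/cfun_fst.
- exact: cfun_snd.
Qed.

Lemma cfun_word_ball X (nX : numbering X) (D : X * nat -> rat_ball)
    (w : X -> seq nat) : cfun D -> cfun w ->
  cfun (fun x => word_ball (fun i => D (x, i)) (w x)).
Proof.
move=> cfunD wc; apply: (cfun_foldr (f := fun y : X * (nat * rat_ball) =>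
  ball_mul (min_ball (fun i => D (y.1, i)) (letter_form y.2.1)) y.2.2)) => //.
  apply: cfun_ball_mul; last exact/cfun_snd/cfun_snd/cfun_id.
  apply: (cfun_min_ball
    (D := fun z : (X * (nat * rat_ball)) * nat => D (z.1.1, z.2))).
    apply: cfun_comp cfunD _; apply: cfun_pair; last exact/cfun_snd/cfun_id.
    exact/cfun_fst/cfun_fst/cfun_id.
  apply: cfun_num; apply: (cfun_nat1 rec_half).
  exact/cfun_fst/cfun_snd/cfun_id.
exact: cfun_cst.
Qed.

Lemma decode_qiE n : decode_qi n = of_num n.
Proof.
rewrite /decode_qi /= /code_tail /code_head CodeSeq.codeK.
by case: (CodeSeq.decode n) => [|a [|b s]].
Qed.

Lemma decode_seqE n : CodeSeq.decode n = of_num n.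
Proof. by rewrite /= map_id. Qed.

Lemma cfun_decode X (nX : numbering X) (f : X -> nat) : cfun f ->
  cfun (fun x => CodeSeq.decode (f x)).
Proof.
by move=> fc; apply: (cfun_ext _ (cfun_num fc)) => x; rewrite -decode_seqE.
Qed.

Lemma cfun_monomial_ball X (nX : numbering X) (D : X * nat -> rat_ball)
    (f : X -> nat) : cfun D -> cfun f ->
  cfun (fun x => monomial_ball (fun i => D (x, i)) (f x)).
Proof.
move=> cfunD /cfun_decode sc.
have qc : cfun (fun x => decode_qi (head 0%N (CodeSeq.decode (f x)))).
  apply: (cfun_ext _ (cfun_num (cfun_head sc))) => x.
  by rewrite decode_qiE.
have wc : cfun (fun x =>
    word_ball (fun i => D (x, i)) (behead (CodeSeq.decode (f x)))).
  by apply: cfun_word_ball => //; exact: cfun_behead.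
by apply: cfun_pair; apply: cfun_ball_mul => //; apply: cfun_ball_cst;
  [exact: cfun_fst|exact: cfun_snd].
Qed.

Lemma cfun_poly_ball X (nX : numbering X) (D : X * nat -> rat_ball)
    (f : X -> nat) : cfun D -> cfun f ->
  cfun (fun x => poly_ball (fun i => D (x, i)) (f x)).
Proof.
move=> cfunD /cfun_decode sc; apply: (cfun_foldr
  (f := fun y : X * (nat * (rat_ball * rat_ball)) =>
    (ball_add (monomial_ball (fun i => D (y.1, i)) y.2.1).1 y.2.2.1,
     ball_add (monomial_ball (fun i => D (y.1, i)) y.2.1).2 y.2.2.2))) => //;
  last exact: cfun_cst.
have mc : cfun (fun y : X * (nat * (rat_ball * rat_ball)) =>
    monomial_ball (fun i => D (y.1, i)) y.2.1).
  apply: (cfun_monomial_ball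
    (D := fun z : (X * (nat * (rat_ball * rat_ball))) * nat => D (z.1.1, z.2))).
    apply: cfun_comp cfunD _; apply: cfun_pair; last exact/cfun_snd/cfun_id.
    exact/cfun_fst/cfun_fst/cfun_id.
  exact/cfun_fst/cfun_snd/cfun_id.
have ac : cfun (fun y : X * (nat * (rat_ball * rat_ball)) => y.2.2).
  exact/cfun_snd/cfun_snd/cfun_id.
by apply: cfun_pair; apply: cfun_ball_add; do ?[exact: cfun_fst|exact: cfun_snd].
Qed.

(** * Values of rational vectors *)

Local Open Scope classical_set_scope.

Section generators.
Variables (R : realType) (X : topologicalType) (P : presentation R X).

Lemma continuous_real_complex (f : X -> R) : continuous f ->
  continuous (fun x => Complex (f x) 0 : cplx R).
Proof.
move=> fc x; apply/cvgrPdist_lt => -[e e'] ee.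
have [/eqP e'0 e0] : e' == 0 /\ 0 < e by move: ee; rewrite ltcE/= => /andP[].
have /cvgrPdist_lt/(_ e e0) := fc x.
apply: filterS => y fxy.
rewrite [X in X < _](_ : _ = Complex `|f x - f y| 0); last first.
  by rewrite /Num.Def.normr/= subr0 expr0n/= addr0 sqrtr_sqr.
by rewrite ltcE/= e'0 eqxx.
Qed.

Lemma continuous_metric (p : X) : continuous (metric P p).
Proof.
move=> x; apply/cvgrPdist_lt => e e0.
rewrite near_simpl /prop_near1 (metric_nbhs (metricP P)); exists e => // y /= xy.
have t1 := metric_tri (metricP P) p x y.
have t2 := metric_tri (metricP P) p y x.
rewrite (metric_symm (metricP P) y x) in t2.
by rewrite ltr_norml; apply/andP; split; lra.
Qed.

Lemma continuous_min_eval (g : min_form) :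
  continuous (fun x => min_eval (fun i => metric P (dpoint P i) x) g : R).
Proof.
case: g => q; elim=> [|t s IH] x; first exact: cvg_cst.
rewrite /min_eval /=; apply: (@continuous_min R X _ _ x); last exact: IH.
apply: (@cvgD R R^o); first exact: cvg_cst.
apply: (@cvgM R); first exact: cvg_cst.
exact: continuous_metric.
Qed.

Definition min_vector (g : min_form) : Cstar R X :=
  mkcts (continuous_real_complex (@continuous_min_eval g)).

Lemma min_vectorE g x : min_vector g x =
  Complex (min_eval (fun i => metric P (dpoint P i) x) g) 0.
Proof. by []. Qed.

Definition min_generator (j : nat) : Cstar R X := min_vector (of_num j).

End generators.

Section Cstar_values.
Variables (R : realType) (X : topologicalType).
Implicit Types f g : Cstar R X.

Lemma Cstar_addE f g x : (f + g) x = f x + g x. Proof. by []. Qed.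
Lemma Cstar_subE f g x : (f - g) x = f x - g x. Proof. by []. Qed.
Lemma Cstar_mulE f g x : (f * g) x = f x * g x. Proof. by []. Qed.
Lemma Cstar_scaleE a f x : (a *: f) x = a * f x. Proof. by []. Qed.
Lemma Cstar_starE f x : Cstar_star f x = (f x)^*. Proof. by []. Qed.

End Cstar_values.

Section enclosure_of_rational_vectors.
Variables (R : realType) (X : topologicalType) (P : presentation R X).
Variables (D : nat -> rat_ball) (x : X).
Hypothesis DP : forall i, in_ball (D i) (metric P (dpoint P i) x).

Lemma in_min_ball g : in_ball (min_ball D g)
  (min_eval (fun i => metric P (dpoint P i) x) g).
Proof.
case: g => q; elim=> [|t s IH] /=; first exact: in_ball_cst.
apply: in_ball_min; last exact: IH.
apply: in_ball_add; first exact: in_ball_cst.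
by apply: in_ball_mul; [exact: in_ball_cst|exact: DP].
Qed.

(** The generators are real-valued, so conjugation acts trivially and a word has a real value,
    starred letters included. *)
Lemma word_value (w : seq nat) : exists2 y : R, in_ball (word_ball D w) y &
  (\prod_(l <- [seq (l./2, odd l) | l <- w])
    (if l.2 then Cstar_star (min_generator P l.1) else min_generator P l.1)) x
    = Complex y 0.
Proof.
elim: w => [|l w [y wy IH]].
  exists 1; last by rewrite big_nil.
  by have := in_ball_cst R 1; rewrite rmorph1.
exists (min_eval (fun i => metric P (dpoint P i) x) (letter_form l) * y).
  by apply: in_ball_mul => //; exact: in_min_ball.
rewrite big_cons Cstar_mulE IH /=.
have -> : (if odd l then Cstar_star (min_generator P l./2)
    else min_generator P l./2) x = min_vector P (letter_form l) x.
  case: ifP => // _; rewrite Cstar_starE /min_generator min_vectorE.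
  by apply/eqP; rewrite eq_complex /= oppr0 !eqxx.
rewrite min_vectorE.
by apply/eqP; rewrite eq_complex /= !mulr0 !mul0r subr0 addr0 !eqxx.
Qed.

Lemma in_poly_ball n : exists a b : R,
  [/\ in_ball (poly_ball D n).1 a, in_ball (poly_ball D n).2 b &
      rational_vector (min_generator P) n x = Complex a b].
Proof.
rewrite /rational_vector /star_poly_eval /poly_ball /decode_poly.
elim: (CodeSeq.decode n) => [|m s [a [b [IHa IHb IH]]]].
  exists 0, 0; rewrite big_nil /=.
  by have := in_ball_cst R 0; rewrite rmorph0.
pose q := decode_qi (head 0%N (CodeSeq.decode m)).
have [y yw yE] := word_value (behead (CodeSeq.decode m)).
exists (ratr q.1 * y + a), (ratr q.2 * y + b); split.
- by apply: in_ball_add => //; apply: in_ball_mul => //; exact: in_ball_cst.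
- by apply: in_ball_add => //; apply: in_ball_mul => //; exact: in_ball_cst.
rewrite /= big_cons Cstar_addE IH Cstar_scaleE yE.
by apply/eqP; rewrite eq_complex /= !mulr0 subr0 add0r !eqxx.
Qed.

End enclosure_of_rational_vectors.

(** * The supremum norm *)

Section modulus.
Variable R : realType.
Implicit Types z w : cplx R.

(** Translates the library norm, whose values are complex numbers, into the real-valued modulus. *)
Lemma modulusE z : `|z| = Complex (modulus z) 0.
Proof. by case: z. Qed.

Lemma modulusD z w : modulus (z + w) <= modulus z + modulus w.
Proof.
have := ler_normD z w; rewrite !modulusE lecE /= => /andP[_].
by [].
Qed.

Lemma modulusN z : modulus (- z) = modulus z.
Proof. by have := normrN z; rewrite !modulusE => -[]. Qed.

Lemma modulus_ge0 z : 0 <= modulus z.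
Proof. by case: z => a b; exact: sqrtr_ge0. Qed.

Lemma modulus_le (a b : R) : modulus (Complex a b) <= `|a| + `|b|.
Proof.
rewrite /modulus /= -[leRHS]ger0_norm ?addr_ge0// -sqrtr_sqr ler_wsqrtr//.
rewrite sqrrD !real_normK ?num_real//.
by have := mulr_ge0 (normr_ge0 a) (normr_ge0 b); lra.
Qed.

Lemma modulus_subC z w : modulus (z - w) = modulus (w - z).
Proof. by rewrite -modulusN opprB. Qed.

Lemma ler_modulus_dist z w : `|modulus z - modulus w| <= modulus (z - w).
Proof.
have h1 := modulusD (z - w) w; have h2 := modulusD (w - z) z.
rewrite !subrK in h1 h2; rewrite (modulus_subC w z) in h2.
by rewrite ler_norml; apply/andP; split; lra.
Qed.

Lemma Re_le_modulus z : `|complex.Re z| <= modulus z.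
Proof.
case: z => a b /=; rewrite /modulus /= -sqrtr_sqr ler_wsqrtr// lerDl.
exact: sqr_ge0.
Qed.

Lemma Im_le_modulus z : `|complex.Im z| <= modulus z.
Proof.
case: z => a b /=; rewrite /modulus /= -sqrtr_sqr ler_wsqrtr// lerDr.
exact: sqr_ge0.
Qed.

End modulus.

Section sup_norm.
Variables (R : realType) (X : topologicalType).
Implicit Types f g : Cstar R X.

Lemma near_modulus f (x : X) (e : R) : 0 < e ->
  \forall y \near x, modulus (f x - f y) < e.
Proof.
move=> e0; have fx : {for x, continuous (f : X -> cplx R)} by exact: cts_fun.
have ee : (0 : cplx R) < Complex e 0 by rewrite ltcE /= eqxx.
have /cvgrPdist_lt/(_ _ ee) := fx.
by apply: filterS => y; rewrite modulusE ltcE /= eqxx.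
Qed.

Lemma continuous_modulus f : continuous (fun x => modulus (f x)).
Proof.
move=> x; apply/cvgrPdist_lt => e e0; apply: filterS (near_modulus f x e0).
by move=> y; exact/le_lt_trans/ler_modulus_dist.
Qed.

Hypothesis X_compact : compact [set: X].

Lemma modulus_bounded f : exists M : R, forall x, modulus (f x) <= M.
Proof.
(* The extreme value theorem asks for a point; the empty space is treated apart. *)
have [[x0 _]|nX] := pselect (exists x0 : X, True); last first.
  by exists 0 => x; case: nX; exists x.
have [] := @compact_EVT_max X R (fun x => modulus (f x)) [set: X].
- by exists x0.
- exact: X_compact.
- exact/continuous_subspaceT/continuous_modulus.
by move=> c _ cP; exists (modulus (f c)) => x; apply: cP; rewrite ?inE.
Qed.

Lemma modulus_le_sup_norm f x : modulus (f x) <= sup_norm f.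
Proof.
have [M fM] := modulus_bounded f.
by apply: ub_le_sup; [exists M => _ [y _ <-]|exists x].
Qed.

(** A point is assumed because [sup] of the empty set is the default 0, which a negative [M] does
    not bound. *)
Lemma sup_norm_le f (M : R) : (exists x : X, True) ->
  (forall x, modulus (f x) <= M) -> sup_norm f <= M.
Proof.
move=> [x0 _] fM; apply: ge_sup; first by exists (modulus (f x0)), x0.
by move=> _ [y _ <-].
Qed.

End sup_norm.

(** * Density *)

Lemma exists_invpow2 (F : archiRealFieldType) (e : F) : 0 < e ->
  exists n, 2^-1 ^+ n < e.
Proof.
move=> e0; exists (Num.bound e^-1); set n := Num.bound _.
have en : e^-1 < n%:R by rewrite archi_boundP// invr_ge0 ltW.
rewrite exprVn invf_plt ?posrE ?exprn_gt0// (lt_trans en)//.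
by rewrite -natrX ltr_nat ltn_expl.
Qed.

Section density.
Variables (R : realType) (X : topologicalType) (P : presentation R X).
Hypothesis X_compact : compact [set: X].
Variable net : nat -> nat.
Hypothesis netP : @total_boundedness_function R (space_of P) net.

Let d := metric P.

Let d_ge0 x y : 0 <= d x y.
Proof.
have := metric_tri (metricP P) x y x.
by rewrite (metric_refl (metricP P)) (metric_symm (metricP P) y x) /d; lra.
Qed.

(** For close points continuity of [h] gives the bound. At a distance of at least r / 2, a slope
    above 4 M / r contributes at least 2 M, which bounds the variation of [h]. *)
Lemma almost_lipschitz (h : X -> R) (M e : R) : continuous h ->
  (forall x, `|h x| <= M) -> 0 < e ->
  exists L : nat, forall x y, h x <= h y + L%:R * d x y + e.
Proof.
move=> hc hM e0.
have M0 : 0 <= M by exact: le_trans (normr_ge0 _) (hM (dpoint P 0)).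
(* Compactness in its near-covering form: what holds near each point for all large [L] holds
   everywhere for all large [L]. *)
have [|N _ NP] := (compact_near_coveringP [set: X]).1 X_compact nat \oo
    (fun L x => forall y, h x <= h y + L%:R * d x y + e) _; last first.
  by exists N => x y; exact: (NP N (leqnn N)).
move=> x _.
have /cvgrPdist_lt/(_ (e / 2)) := hc x.
rewrite divr_gt0// => /(_ isT).
rewrite near_simpl /prop_near1 (metric_nbhs (metricP P)) => -[r /= r0 rP].
pose N := Num.bound (4 * M / r).
have NM : 2 * M <= N%:R * (r / 2).
  have : 4 * M / r < N%:R by rewrite archi_boundP// divr_ge0 ?mulr_ge0// ltW.
  by rewrite ltr_pdivrMr//; lra.
exists ([set y | d x y < r / 2], [set L | (N <= L)%N]) => /=.
  split; last by exists N.
  rewrite (metric_nbhs (metricP P)); exists (r / 2) => //=.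
  exact: divr_gt0.
move=> [x' L] /= [xx' NL] y.
have LN : N%:R <= L%:R :> R by rewrite ler_nat.
have hx' : `|h x - h x'| < e / 2 by apply: rP => /=; rewrite -/d; lra.
have [x'y|x'y] := ltP (d x' y) (r / 2).
  have hy : `|h x - h y| < e / 2.
    apply: rP => /=; have := metric_tri (metricP P) x x' y.
    by rewrite -/d; lra.
  have Ld : 0 <= L%:R * d x' y by rewrite mulr_ge0.
  by move: hx' hy; rewrite !ltr_norml => /andP[? ?] /andP[? ?]; lra.
have Ld : N%:R * (r / 2) <= L%:R * d x' y by apply: ler_pM => //; lra.
have := hM x'; have := hM y; rewrite !ler_norml => /andP[? ?] /andP[? ?].
by lra.
Qed.

Lemma min_eval_le (D : nat -> R) (g : min_form) t : t \in g.2 ->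
  min_eval D g <= ratr t.1 + ratr t.2.1 * D t.2.2.
Proof.
case: g => q s; rewrite /min_eval /=; elim: s => //= u s IH.
by rewrite in_cons ge_min => /orP[/eqP ->|/IH ->]; rewrite ?lexx ?orbT.
Qed.

Lemma min_eval_ge (D : nat -> R) (g : min_form) c : c <= ratr g.1 ->
  (forall t, t \in g.2 -> c <= ratr t.1 + ratr t.2.1 * D t.2.2) ->
  c <= min_eval D g.
Proof.
case: g => q s; rewrite /min_eval /= => cq; elim: s => //= u s IH us.
rewrite le_min us ?mem_head// IH// => t ts.
by rewrite us// in_cons ts orbT.
Qed.

(** Every term stays above h - e', since q_k >= h(p_k). The term of a net point p_k near x is at
    most h(x) + 4 e': one e' for rounding h(p_k), one for the error in [almost_lipschitz], and two
    for L d(p_k, x), which occurs twice. *)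
Lemma min_eval_dense (h : X -> R) (M e : R) : continuous h ->
  (forall x, `|h x| <= M) -> 0 < e -> exists g : min_form, forall x,
  `|min_eval (fun i => d (dpoint P i) x) g - h x| <= e.
Proof.
move=> hc hM e0; pose e' := e / 4.
have e'0 : 0 < e' by rewrite divr_gt0.
have eE : e = 4 * e' by rewrite /e'; field.
have [L LP] := almost_lipschitz hc hM e'0.
(* The net is so fine that L times its mesh is at most [e']; [L.+1] avoids a division by 0. *)
have [j jP] : exists j, 2^-1 ^+ j < e' / L.+1%:R.
  by apply: exists_invpow2; rewrite divr_gt0.
have Lj (t : R) : 0 <= t -> t < 2^-1 ^+ j -> L%:R * t <= e'.
  move=> t0 tj; have := lt_trans tj jP; rewrite ltr_pdivlMr// => tL.
  by rewrite -natr1 in tL; lra.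
have ex k : exists q : rat, h (dpoint P k) <= ratr q <= h (dpoint P k) + e'.
  have /rat_in_itvoo[q] : h (dpoint P k) < h (dpoint P k) + e' by rewrite ltrDl.
  by rewrite in_itv => /andP[/ltW ? /ltW ?]; exists q; apply/andP.
have /choice[q qP] := ex.
(* The constant [b] lies above all values of [h], so it does not spoil the lower bound. *)
have /rat_in_itvoo[b] : M < M + 1 by rewrite ltrDl.
rewrite in_itv => /andP[/= Mb _].
exists (b, [seq (q k, (L%:R, k)) | k <- CodeSeq.decode (net j)]) => x.
rewrite ler_norml; apply/andP; split.
  rewrite lerBrDr; apply: min_eval_ge => /=.
    have := hM x; rewrite ler_norml => /andP[_ ?]; lra.
  move=> _ /mapP[k _ ->] /=; rewrite ratr_nat.
  have := LP x (dpoint P k); have /andP[? _] := qP k.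
  rewrite /d (metric_symm (metricP P) x) => ?.
  by lra.
have [k kj kx] := netP j x; rewrite -exprVn in kx.
rewrite lerBlDr; apply: le_trans (min_eval_le _ (t := (q k, (L%:R, k))) _) _.
  by apply/mapP; exists k.
rewrite /= ratr_nat; have /andP[_ ?] := qP k.
have := Lj _ (d_ge0 _ _) kx; rewrite /= -/d => ?.
have := LP (dpoint P k) x => ?.
by lra.
Qed.

End density.

Section rational_vectors_dense.
Variables (R : realType) (X : topologicalType) (P : presentation R X).
Hypothesis X_compact : compact [set: X].
Variable net : nat -> nat.
Hypothesis netP : @total_boundedness_function R (space_of P) net.

Lemma continuous_of_modulus (f : Cstar R X) (h : cplx R -> R) :
  {morph h : z w / z - w} -> (forall z, `|h z| <= modulus z) ->
  continuous (fun x => h (f x)).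
Proof.
move=> hB hle x; apply/cvgrPdist_lt => e e0.
apply: filterS (near_modulus f x e0) => y.
by rewrite -hB; exact/le_lt_trans.
Qed.

Lemma min_generator_dense : dense_points (Cstar_space (min_generator P)).
Proof.
move=> f e e0; have [M fM] := modulus_bounded X_compact f.
have e3 : 0 < e / 3 by rewrite divr_gt0.
have part (h : cplx R -> R) : {morph h : z w / z - w} ->
    (forall z, `|h z| <= modulus z) -> exists j, forall x,
    `|min_eval (fun i => metric P (dpoint P i) x) (of_num j) - h (f x)| <= e / 3.
  move=> hB hle; have hc := continuous_of_modulus hB hle.
  have hM x : `|h (f x)| <= M by exact: le_trans (hle _) (fM x).
  have [g gP] := min_eval_dense X_compact netP (hc f) hM e3.
  by have [j jg] := of_num_surj g; exists j => x; rewrite jg; exact: gP.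
have [j1 P1] := part (@complex.Re R) (fun z w => ltac:(by case: z; case: w))
  (@Re_le_modulus R).
have [j2 P2] := part (@complex.Im R) (fun z w => ltac:(by case: z; case: w))
  (@Im_le_modulus R).
(* The polynomial x_j1 + i x_j2 recombines the approximations of the real and the imaginary part. *)
have [n nP] := decode_poly_surj
  [:: ((1, 0), [:: (j1, false)]); ((0, 1), [:: (j2, false)])].
exists n; rewrite /= /rational_vector nP.
(* Two thirds of [e] leave room for strictness, as [sup_norm_le] yields a weak inequality. *)
apply: le_lt_trans (_ : e / 3 + e / 3 < e); last lra.
apply: sup_norm_le; first by exists (dpoint P 0).
move=> x; rewrite Cstar_subE /star_poly_eval !big_cons !big_nil !addr0 !mulr1.
rewrite Cstar_addE !Cstar_scaleE /min_generator !min_vectorE.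
have := P1 x; have := P2 x; move: (f x) => [a b] /= h2 h1.
apply: le_trans (lerD h1 h2); apply: le_trans (modulus_le _ _).
rewrite /modulus /= !rmorph0 !rmorph1.
by rewrite !mul1r !mul0r !subr0 !addr0 !add0r.
Qed.

End rational_vectors_dense.

(** * Computability of the presentation *)

Section evaluation.
Variables (R : realType) (X : topologicalType) (P : presentation R X).
Hypothesis X_compact : compact [set: X].
Variable net : nat -> nat.
Hypothesis netP : @total_boundedness_function R (space_of P) net.
Hypothesis net_computable : cfun net.
(* [rdist (k, (i, j))] approximates the distance of the distinguished points
[k] and [i] up to [2 ^- j]. *)
Variable rdist : nat * (nat * nat) -> rat.
Hypothesis rdist_computable : cfun rdist.
Hypothesis rdistP : forall k i j,
  `|ratr (rdist (k, (i, j))) - metric P (dpoint P k) (dpoint P i)| < 2^-1 ^+ j.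

Let d := metric P.
Let p := dpoint P.
Let u := min_generator P.

(* Encloses [d (p i) x] for all [x] at distance less than [2 ^- j] of [p k],
where [y = ((n, (k, j)), i)]. *)
Definition dist_ball (y : nat * (nat * nat) * nat) : rat_ball :=
  (rdist (y.1.2.1, (y.2, y.1.2.2)), 2 * 2^-1 ^+ y.1.2.2).

Definition vector_ball (y : nat * (nat * nat)) : rat_ball * rat_ball :=
  poly_ball (fun i => dist_ball (y, i)) y.1.

Definition center y : rat * rat := ((vector_ball y).1.1, (vector_ball y).2.1).
(** The sum of the radii of both parts bounds the modulus of the error, by [modulus_le]. *)
Definition radius y : rat := (vector_ball y).1.2 + (vector_ball y).2.2.

Lemma cfun_vector_ball : cfun vector_ball.
Proof.
apply: (cfun_poly_ball (D := dist_ball)); last exact/cfun_fst/cfun_id.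
have kc : cfun (fun y : nat * (nat * nat) * nat => y.1.2).
  exact/cfun_snd/cfun_fst/cfun_id.
apply: cfun_pair.
  apply: cfun_comp rdist_computable _; apply: cfun_pair; first exact: cfun_fst.
  by apply: cfun_pair; [exact/cfun_snd/cfun_id|exact: cfun_snd].
by apply: cfun_mulr; [exact: cfun_cst|exact/cfun_invpow2/cfun_snd].
Qed.

Lemma cfun_center : cfun center.
Proof.
by apply: cfun_pair; apply: cfun_fst; [apply: cfun_fst|apply: cfun_snd];
  exact: cfun_vector_ball.
Qed.

Lemma cfun_radius : cfun radius.
Proof.
by apply: cfun_addr; apply: cfun_snd; [apply: cfun_fst|apply: cfun_snd];
  exact: cfun_vector_ball.
Qed.

Lemma centerP n k j x : d (p k) x < 2^-1 ^+ j ->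
  modulus (rational_vector u n x - cplx_of_qi R (center (n, (k, j))))
    <= ratr (radius (n, (k, j))).
Proof.
move=> kx.
(* Since x is near p_k, d(p_i, x) differs from d(p_k, p_i) by less than 2^-j; [rdist] adds an error
   below 2^-j. Hence the factor 2 in [dist_ball]. *)
have [i|a [b [aP bP ->]]] :=
  @in_poly_ball R X P (fun i => dist_ball ((n, (k, j)), i)) x _ n.
  rewrite /in_ball /= rmorphM rmorphXn fmorphV rmorph_nat/=.
  have := rdistP k i j; rewrite -/p -/d => h.
  have t1 := metric_tri (metricP P) (p k) x (p i).
  have t2 := metric_tri (metricP P) (p i) (p k) x.
  rewrite (metric_symm (metricP P) x) (metric_symm (metricP P) (p i) (p k)) in t1 t2.
  rewrite -/d in t1 t2; rewrite -/p -/d.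
  by move: h; rewrite ltr_norml ler_norml => /andP[? ?]; apply/andP; split; lra.
apply: le_trans (modulus_le _ _) _; rewrite /radius rmorphD/=.
by apply: lerD; [exact: aP|exact: bP].
Qed.

(** The function d(p_0, -) is continuous on a compact space, hence bounded, and d(x, y) <= d(p_0, x)
    + d(p_0, y). *)
Lemma metric_bounded : exists C : nat, forall x y, d x y <= C%:R.
Proof.
have [M MP] := modulus_bounded X_compact (dist_vector P (p 0%N)).
have {}MP x : d (p 0%N) x <= M.
  apply: le_trans (MP x); apply: le_trans (ler_norm _) _.
  exact: (Re_le_modulus (Complex _ 0)).
have M0 : 0 <= M.
  by apply: le_trans (MP (p 0%N)); rewrite /d (metric_refl (metricP P)).
exists (Num.bound (2 * M)) => x y.
have : 2 * M < (Num.bound (2 * M))%:R by rewrite archi_boundP// mulr_ge0.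
have := metric_tri (metricP P) x (p 0%N) y.
have := MP x; have := MP y.
rewrite (metric_symm (metricP P) x (p 0%N)) -/d => ? ? ? ?; lra.
Qed.

Lemma radius_small n e : 0 < e -> exists j, forall k, radius (n, (k, j)) < e.
Proof.
move=> e0; have [C dC] := metric_bounded.
(* The approximate distances are at most C + 1 in absolute value and their radii are 2 * 2^-j;
   [C.+2] covers both. *)
have [B BP] := poly_ball_le C.+2%:R n.
have B0 : 0 < `|B| + 1 by rewrite ltr_pwDr.
(* The radius is a sum of two radii, each at most B 2^-j. *)
have [|j jP] := @exists_invpow2 rat (e / (2 * (`|B| + 1))).
  by rewrite divr_gt0// mulr_gt0.
exists j => k.
have j0 : 0 <= 2^-1 ^+ j :> rat by rewrite exprn_ge0.
have j1 : 2^-1 ^+ j <= 1 :> rat by rewrite exprn_ile1.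
have [i|[_ _ h1] [_ _ h2]] := BP _ (fun i => dist_ball ((n, (k, j)), i)) j0 j1.
  split => /=; last 2 first.
  - by rewrite mulr_ge0.
  - by rewrite ler_wpM2r// ler_nat.
  rewrite -(ler_rat R) ratr_norm ratr_nat.
  have h := rdistP k i j; have := dC (p k) (p i).
  have j1' : 2^-1 ^+ j <= 1 :> R by rewrite exprn_ile1// invf_le1// ler1n.
  have h0 : 0 <= d (p k) (p i).
    have := metric_tri (metricP P) (p k) (p i) (p k).
    by rewrite (metric_refl (metricP P)) (metric_symm (metricP P) (p i)) -/d; lra.
  rewrite -addn2 natrD => h'.
  move: h; rewrite ltr_norml ler_norml -/p -/d => /andP[? ?].
  by apply/andP; split; lra.
rewrite ltr_pdivlMr ?mulr_gt0// in jP.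
have hB : B * 2^-1 ^+ j <= `|B| * 2^-1 ^+ j by rewrite ler_wpM2r// ler_norm.
by rewrite /radius; lra.
Qed.

(** The point [p n] is at distance 0 from itself, so every [j] gives an enclosure of the value
    there; the search finds one with small radius. *)
Lemma computable_hat : exists2 f : nat * (nat * nat) -> rat * rat, cfun f &
  forall m n k, modulus (rational_vector u m (p n) - cplx_of_qi R (f (m, (n, k))))
    < 2^-1 ^+ k.+1.
Proof.
have [||h hc hP] := @cfun_search (nat * (nat * nat)) nat _ _ (fun x =>
    radius (x.1.1, (x.1.2.1, x.2)) < 2^-1 ^+ x.1.2.2.+1).
- apply: cfun_ltr.
    apply: cfun_comp cfun_radius _; apply: cfun_pair.
      exact/cfun_fst/cfun_fst/cfun_id.
    apply: cfun_pair; last exact/cfun_snd/cfun_id.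
    exact/cfun_fst/cfun_snd/cfun_fst/cfun_id.
  apply: cfun_invpow2.
  apply: (cfun_nat1 (f := succn) (rec_fun_succ (rec_fun_proj 1 0))).
  exact/cfun_snd/cfun_snd/cfun_fst/cfun_id.
- move=> [m [n k]] /=.
  have [|j jP] := @radius_small m (2^-1 ^+ k.+1); first by rewrite exprn_gt0.
  by exists j.
exists (fun x => center (x.1, (x.2.1, h x))).
  apply: cfun_comp cfun_center _; apply: cfun_pair; first exact/cfun_fst/cfun_id.
  by apply: cfun_pair => //; exact/cfun_fst/cfun_snd/cfun_id.
move=> m n k /=; have /= := hP (m, (n, k)).
rewrite -(ltr_rat R) rmorphXn fmorphV rmorph_nat /=; apply: le_lt_trans.
by apply: centerP; rewrite /d (metric_refl (metricP P)) exprn_gt0// invr_gt0.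
Qed.

(** For the empty list the maximum is set to 0, hence the alternative in the last clause. *)
Lemma max_of_seq (g : nat -> R) (s : seq nat) : (forall k, 0 <= g k) ->
  exists M, [/\ 0 <= M, forall k, k \in s -> g k <= M &
    M = 0 \/ exists2 k, k \in s & g k = M].
Proof.
move=> g0; elim: s => [|k s [M [M0 gM MP]]]; first by exists 0; split => //; left.
have [kM|Mk] := leP (g k) M.
  exists M; split => //.
    by move=> l; rewrite in_cons => /orP[/eqP ->//|]; exact: gM.
  case: MP => [|[l ls lM]]; [by left|right; exists l => //].
  by rewrite in_cons ls orbT.
exists (g k); split => //.
  by move=> l; rewrite in_cons => /orP[/eqP ->//|/gM/le_trans]; apply; exact: ltW.
by right; exists k; rewrite ?mem_head.
Qed.

(** Squares keep the comparison of moduli within rational arithmetic. *)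
Let sqnorm y : rat := (center y).1 ^+ 2 + (center y).2 ^+ 2.

Let modulus_center y : modulus (cplx_of_qi R (center y)) ^+ 2 = ratr (sqnorm y).
Proof.
rewrite /modulus /= sqr_sqrtr ?addr_ge0 ?sqr_ge0//.
by rewrite rmorphD !rmorphXn.
Qed.

(* For [x = ((n, K), (j, q))]: the rational vector [n] is known up to
[e = 2 ^- (K + 2)] on the balls of radius [2 ^- j] around the points of the
net, and [q] exceeds the largest modulus of their centers by at most [e]. *)
Let norm_test (x : (nat * nat) * (nat * rat)) : bool :=
  let e : rat := 2^-1 ^+ x.1.2.+2 in
  let s := CodeSeq.decode (net x.2.1) in
  if all (fun k => if radius (x.1.1, (k, x.2.1)) < e
                   then sqnorm (x.1.1, (k, x.2.1)) < x.2.2 * x.2.2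
                   else false) s
  then if 0 < x.2.2 then
    if x.2.2 < e then true
    else has (fun k => (x.2.2 - e) * (x.2.2 - e) < sqnorm (x.1.1, (k, x.2.1))) s
  else false else false.

Let cfun_norm_test : cfun norm_test.
Proof.
have sqc : cfun sqnorm.
  by apply: cfun_addr; apply: cfun_mulr;
    [exact/cfun_fst/cfun_center|exact/cfun_fst/cfun_center
    |exact/cfun_snd/cfun_center|exact/cfun_snd/cfun_center].
have ec : cfun (fun x : (nat * nat) * (nat * rat) => 2^-1 ^+ x.1.2.+2 : rat).
  apply: cfun_invpow2.
  do 2![apply: (cfun_nat1 (f := succn) (rec_fun_succ (rec_fun_proj 1 0)))].
  exact/cfun_snd/cfun_fst/cfun_id.
have sc : cfun (fun x : (nat * nat) * (nat * rat) => CodeSeq.decode (net x.2.1)).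
  by apply: cfun_decode; apply: cfun_comp net_computable _;
    exact/cfun_fst/cfun_snd/cfun_id.
have qc : cfun (fun x : (nat * nat) * (nat * rat) => x.2.2).
  exact/cfun_snd/cfun_snd/cfun_id.
have yc : cfun (fun z : (nat * nat) * (nat * rat) * nat =>
    (z.1.1.1, (z.2, z.1.2.1))).
  apply: cfun_pair; first exact/cfun_fst/cfun_fst/cfun_fst/cfun_id.
  apply: cfun_pair; first exact/cfun_snd/cfun_id.
  exact/cfun_fst/cfun_snd/cfun_fst/cfun_id.
have up A (nA : numbering A) (f : (nat * nat) * (nat * rat) -> A) :
    cfun f -> cfun (fun z : (nat * nat) * (nat * rat) * nat => f z.1).
  by move=> fc; apply: cfun_comp fc _; exact/cfun_fst/cfun_id.
apply: cfun_if; last exact: cfun_cst.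
  apply: (cfun_all (p := fun z : (nat * nat) * (nat * rat) * nat =>
    if radius (z.1.1.1, (z.2, z.1.2.1)) < 2^-1 ^+ z.1.1.2.+2
    then sqnorm (z.1.1.1, (z.2, z.1.2.1)) < z.1.2.2 * z.1.2.2 else false)) => //.
  apply: cfun_if; last exact: cfun_cst.
    by apply: cfun_ltr; [exact: cfun_comp cfun_radius yc|exact: up ec].
  apply: cfun_ltr; first exact: cfun_comp sqc yc.
  by apply: cfun_mulr; exact: up qc.
apply: cfun_if; last exact: cfun_cst.
  by apply: cfun_ltr => //; exact: cfun_cst.
apply: cfun_if; [exact: cfun_ltr|exact: cfun_cst|].
apply: (cfun_has (p := fun z : (nat * nat) * (nat * rat) * nat =>
    (z.1.2.2 - 2^-1 ^+ z.1.1.2.+2) * (z.1.2.2 - 2^-1 ^+ z.1.1.2.+2)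
      < sqnorm (z.1.1.1, (z.2, z.1.2.1)))) => //.
apply: cfun_ltr; last exact: cfun_comp sqc yc.
by apply: cfun_mulr; apply: cfun_addr; do ?[apply: cfun_oppr];
  [exact: up qc|exact: up ec|exact: up qc|exact: up ec].
Qed.

(** Once the radii are below [e], any rational strictly between the largest modulus [M] of the
    centers and [M + e] passes. *)
Let norm_test_complete n K : exists jq, norm_test ((n, K), jq).
Proof.
pose e : rat := 2^-1 ^+ K.+2; have e0 : 0 < e by rewrite exprn_gt0.
have [j jP] := radius_small n e0.
pose g k := modulus (cplx_of_qi R (center (n, (k, j)))).
have g0 k : 0 <= g k by exact: modulus_ge0.
have [M [M0 gM MP]] := max_of_seq (CodeSeq.decode (net j)) g0.
have /rat_in_itvoo[q] : M < M + ratr e by rewrite ltrDl ltr0q.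
rewrite in_itv => /andP[/= Mq qM]; exists (j, q); rewrite /norm_test /= -/e.
have q0 : 0 < q by rewrite -(ltr0q R) (le_lt_trans M0).
have gq k : k \in CodeSeq.decode (net j) -> sqnorm (n, (k, j)) < q * q.
  move=> ks; rewrite -(ltr_rat R) -modulus_center rmorphM -expr2.
  by rewrite ltr_pXn2r ?nnegrE ?modulus_ge0 ?ler0q ?ltW// (le_lt_trans (gM _ ks)).
have -> : all (fun k => if radius (n, (k, j)) < e
    then sqnorm (n, (k, j)) < q * q else false) (CodeSeq.decode (net j)).
  by apply/allP => k ks; rewrite jP gq.
rewrite q0; case: (ltP q e) => // eq.
have qeM : ratr (q - e) < M by rewrite rmorphB/= ltrBlDr.
(* Here [q >= e]; with [M = 0] the choice of [q] would give [q < e]. *)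
case: MP => [M00|[k ks kM]].
  by move: qeM; rewrite M00 ltrq0 subr_lt0 ltNge eq.
apply/hasP; exists k => //=; rewrite -(ltr_rat R) -modulus_center rmorphM -expr2.
by rewrite ltr_pXn2r ?nnegrE ?modulus_ge0 ?ler0q ?subr_ge0// -/(g k) kM.
Qed.

(** The norm lies above q - 2 e and is at most q + e, while 2^-K = 4 e. *)
Let norm_test_sound n K j q : norm_test ((n, K), (j, q)) ->
  `|ratr q - sup_norm (rational_vector u n)| < 2^-1 ^+ K.
Proof.
rewrite /norm_test /=; set e : rat := 2^-1 ^+ K.+2.
have eK : 2^-1 ^+ K = 4 * ratr e :> R.
  rewrite /e rmorphXn fmorphV rmorph_nat /= 2!exprS.
  by rewrite mulrA mulrA -[4%R]/(2 * 2)%:R natrM; field.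
have e0 : 0 < ratr e :> R by rewrite ltr0q exprn_gt0.
case: ifP => // /allP all_net; case: ifP => // q0 lower.
(* The balls around the net cover the space, so each value has modulus at most that of a center,
   below [q], plus a radius, below [e]. *)
have upper : sup_norm (rational_vector u n) <= ratr q + ratr e.
  apply: sup_norm_le; first by exists (p 0%N).
  move=> x; have [k ks kx] := netP j x; rewrite -exprVn in kx.
  have := all_net k ks; case: ifP => // re.
  rewrite -(ltr_rat R) -modulus_center rmorphM -expr2.
  rewrite ltr_pXn2r ?nnegrE ?modulus_ge0 ?ler0q ?(ltW q0)// => cq.
  have := centerP n kx; rewrite -(ltr_rat R) in re => cx.
  have := modulusD (rational_vector u n x - cplx_of_qi R (center (n, (k, j))))
    (cplx_of_qi R (center (n, (k, j)))).
  by rewrite subrK => ?; lra.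
(* If [q < e], it suffices that the norm is nonnegative. Otherwise some center has modulus above q -
   e, and the value at its net point is within [e] of it. *)
have : ratr q - 2 * ratr e < sup_norm (rational_vector u n).
  move: lower; case: ltP => [qe _|eq /hasP[k ks]].
    have := le_trans (modulus_ge0 _)
      (modulus_le_sup_norm X_compact (rational_vector u n) (p 0%N)).
    by rewrite -(ltr_rat R) in qe; lra.
  rewrite -(ltr_rat R) -modulus_center rmorphM -expr2.
  rewrite ltr_pXn2r ?nnegrE ?modulus_ge0 ?ler0q ?subr_ge0//.
  rewrite [X in X < _ -> _]rmorphB => qc.
  have := all_net k ks; case: ifP => // re _; rewrite -(ltr_rat R) in re.
  have kk : d (p k) (p k) < 2^-1 ^+ j.
    by rewrite /d (metric_refl (metricP P)) exprn_gt0// invr_gt0.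
  have := centerP n kk; rewrite modulus_subC => ck.
  have := modulusD (cplx_of_qi R (center (n, (k, j))) - rational_vector u n (p k))
    (rational_vector u n (p k)).
  have := modulus_le_sup_norm X_compact (rational_vector u n) (p k).
  by rewrite subrK => ? ?; lra.
by rewrite eK ltr_norml => ?; apply/andP; split; lra.
Qed.

Lemma computable_sup_norm : exists2 f : nat * nat -> rat, cfun f &
  forall n K, `|ratr (f (n, K)) - sup_norm (rational_vector u n)| < 2^-1 ^+ K.
Proof.
have [[n K]|h hc hP] := cfun_search cfun_norm_test.
  exact: norm_test_complete.
exists (fun x => (h x).2); first exact: cfun_snd.
move=> n K; apply: (@norm_test_sound n K (h (n, K)).1).
by rewrite -surjective_pairing.
Qed.

Lemma decode_monomialE n : decode_monomial n =
  (decode_qi (head 0%N (CodeSeq.decode n)),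
   [seq (l./2, odd l) | l <- behead (CodeSeq.decode n)]).
Proof. by []. Qed.

Lemma computable_dist_vector : exists2 f : nat -> nat, cfun f &
  forall n, rational_vector u (f n) = dist_vector P (p n).
Proof.
have [C dC] := metric_bounded.
have [q qE] := of_num_surj ((1, 0) : rat * rat).
(* As [C] bounds the metric, the minimum of [C] and d(p_n, -) is d(p_n, -) itself. *)
have [g gr gE] : cfun (fun n : nat => (C%:R, [:: (0, (1, n))]) : min_form).
  apply: cfun_pair; first exact: cfun_cst.
  apply: cfun_cons; last exact: cfun_cst.
  apply: cfun_pair; first exact: cfun_cst.
  by apply: cfun_pair; [exact: cfun_cst|exact: cfun_id].
(* The polynomial is a single monomial with coefficient 1; its letter [(g n).*2] is even, that is,
   unstarred. *)
have [h hr hE] : cfun (fun n : nat => [:: [:: q; (g n).*2]]).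
  apply: cfun_cons; last exact: cfun_cst.
  apply: cfun_cons; first exact: cfun_cst.
  apply: cfun_cons; last exact: cfun_cst.
  by apply: (cfun_nat1 rec_double); exists g.
exists h; first by exists h.
move=> n; apply/continuousEP => x.
have hn : map CodeSeq.decode (CodeSeq.decode (h n)) = [:: [:: q; (g n).*2]].
  by rewrite -[RHS](hE n); apply: eq_map => m; exact: decode_seqE.
rewrite /rational_vector /decode_poly /star_poly_eval.
case: (CodeSeq.decode (h n)) hn => [//|m [|//]] [mE].
have -> : map decode_monomial [:: m] = [:: ((1, 0), [:: (g n, false)])].
  by rewrite /= decode_monomialE mE /= decode_qiE qE odd_double doubleK.
rewrite !big_cons !big_nil addr0 mulr1 Cstar_scaleE.
rewrite /u /min_generator gE min_vectorE /min_eval /=.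
rewrite rmorph0 rmorph1 ratr_nat add0r mul1r min_l; last exact: dC.
apply/eqP; rewrite eq_complex /= rmorph0 rmorph1.
by rewrite !mul0r mul1r subr0 mulr0 addr0 !eqxx.
Qed.

End evaluation.

(** * The presentation by minima and its three computability properties *)

Theorem theorem3p2 (R : realType) (X : topologicalType)
    (X_compact : compact [set: X]) (X_polish : polish R X)
    (P : presentation R X) (P_compact : computably_compact (space_of P)) :
  exists A : Cstar_presentation R X,
    [/\ computable_Cstar_presentation A,
        @computable_maps R (space_of_Cstar A) (complex_space R)
          (fun n => @hat R X (dpoint P n)) &
        @computable_points R (space_of_Cstar A)
          (fun n => dist_vector P (dpoint P n))].
Proof.
have [[D /cfun_computable3 Dc DP] [net /cfun_computable1 netc netP]] := P_compact.
pose rdist (x : nat * (nat * nat)) := decode_rat (D x.1 x.2.1 x.2.2).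
have rdistc : cfun rdist by exact: cfun_num Dc.
have rdistP k i j : `|ratr (rdist (k, (i, j))) -
    metric P (dpoint P k) (dpoint P i)| < 2^-1 ^+ j.
  by rewrite exprVn; exact: DP.
exists (CstarPresentation (min_generator_dense X_compact netP)); split.
- have [f fc fP] := computable_sup_norm X_compact netP netc rdistc rdistP.
  have [g gc gE] := computable2_cfun fc; exists g => // n K /=.
  by rewrite -exprVn (gE n K : decode_rat _ = _); exact: fP.
- have [f fc fP] := computable_hat X_compact rdistc rdistP.
  have [g [c cP] gE] := oracle_cfun fc; exists c => n x nu nuP.
  (* Evaluating the rational vector [nu k.+1] costs 2^-(k+1), and so does its distance to [x]. *)
  exists (fun k => g (nu k.+1) n k) => // k /=.
  rewrite decode_qiE gE /hat -exprVn.
  have := nuP k.+1; rewrite /= -exprVn => h1.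
  have := fP (nu k.+1) n k; rewrite modulus_subC => h2.
  have := modulus_le_sup_norm X_compact
    (rational_vector (min_generator P) (nu k.+1) - x) (dpoint P n).
  rewrite Cstar_subE => h3.
  have := modulusD (cplx_of_qi R (f (nu k.+1, (n, k))) -
      rational_vector (min_generator P) (nu k.+1) (dpoint P n))
    (rational_vector (min_generator P) (nu k.+1) (dpoint P n) - x (dpoint P n)).
  rewrite addrA subrK => /le_lt_trans; apply.
  have -> : 2^-1 ^+ k = 2^-1 ^+ k.+1 + 2^-1 ^+ k.+1 :> R.
    by rewrite exprS; field.
  by apply: ltrD => //; exact: le_lt_trans h3 h1.
- have [f fc fE] := computable_dist_vector P X_compact.
  (* The rational vector equals the distance vector, so its number, repeated for all [k], is a
     name. *)
  have [g gc gE] := computable2_cfun (cfun_comp fc (cfun_fst cfun_id)).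
  exists g => // n k /=; have /= -> := gE n k.
  rewrite fE subrr; apply: le_lt_trans (_ : 0 < _); last first.
    by rewrite -exprVn exprn_gt0// invr_gt0.
  apply: sup_norm_le; first by exists (dpoint P 0%N).
  by move=> x; rewrite /modulus /= expr0n addr0 sqrtr0.
Qed.
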